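(* Let $p$ be a prime and let $F$ be a non-abelian free group of finite rank. Every non-trivial subgroup of $\mathrm{Comm}_p(F)$ normalized by $\mathrm{SComm}_p(F)$ contains $\mathrm{SComm}_p(F)$.
   Context: A subgroup of $F$ is $p$-open if it is open in the pro-$p$ topology of $F$, i.e. if it contains a normal subgroup of $F$ of finite $p$-power index. $\mathrm{Comm}_p(F)$ is the group of equivalence classes $[f]$ of isomorphisms $f:U\to V$ between $p$-open subgroups of $F$, where two such isomorphisms are equivalent if they coincide on some $p$-open subgroup of $F$, with product $[f_1][f_2]=[f_1\circ f_2]$ (for $f_i:U_i\to V_i$, the composition is defined on $f_2^{-1}(V_2\cap U_1)$). For a $p$-open subgroup $H$ of $F$, the canonical homomorphism $\mathrm{Aut}(H)\to\mathrm{Comm}_p(F)$, $\phi\mapsto[\phi]$, is injective, and $\mathrm{Aut}(H)$ is identified with its image. For a free group $H$ of finite rank $r\geq 2$, $\mathrm{SAut}(H)$ is the preimage of $\mathrm{SL}_r(\mathbb Z)$ under the canonical surjection $\mathrm{Aut}(H)\to\mathrm{Aut}(H/[H,H])\cong\mathrm{GL}_r(\mathbb Z)$. $\mathrm{SComm}_p(F)$ is the subgroup of $\mathrm{Comm}_p(F)$ generated by $\mathrm{SAut}(H)$, where $H$ ranges over all $p$-open subgroups of $F$. *)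

(* Defs.v *)
From HB Require Import structures.
From mathcomp Require Import all_boot all_order all_algebra fingroup perm.
From mathcomp Require Import cyclic pgroup abelian.
From mathcomp Require Import boolp classical_sets functions cardinality.

Set Implicit Arguments.
Unset Strict Implicit.
Unset Printing Implicit Defensive.

Local Open Scope classical_set_scope.
Local Notation repr := generic_quotient.repr.

Local Open Scope quotient_scope.
Local Open Scope card_scope.
Local Open Scope group_scope.

Definition is_subgroup (G : groupType) (H : set G) : Prop :=
  group_closed [in H].

Definition is_normal (G : groupType) (N : set G) : Prop :=
  is_subgroup N /\ forall x y, N x -> N (x ^ y).

Definition subgroup_generated (G : groupType) (A : set G) : set G :=
  smallest (@is_subgroup G) A.

Definition derived_subgroup (G : groupType) (H : set G) : set G :=
  subgroup_generated [set [~ x, y] | x in H & y in H].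

Definition left_cosets (G : groupType) (N : set G) : set (set G) :=
  [set [set x * y | y in N] | x in [set: G]].

Definition normalized_by (G : groupType) (K S : set G) : Prop :=
  forall g, K g -> [set s ^ g | s in S] = S.

Definition is_free_basis (F : groupType) (r : nat) (X : 'I_r -> F) : Prop :=
  forall (G : groupType) (f : 'I_r -> G),
    (exists h : {multiplicative F -> G}, forall i, h (X i) = f i) /\
    (forall h1 h2 : {multiplicative F -> G},
       (forall i, h1 (X i) = h2 (X i)) -> forall x, h1 x = h2 x).

Definition free_of_finite_rank (F : groupType) : Prop :=
  exists (r : nat) (X : 'I_r -> F), is_free_basis X.

(* For p prime, [p.-nat n] says exactly that n is a power of p (p_natP). *)
Definition p_open (p : nat) (F : groupType) (U : set F) : Prop :=
  is_subgroup U /\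
  exists (N : set F) (n : nat),
    [/\ is_normal N, N `<=` U, left_cosets N #= `I_n & p.-nat n].

(* An isomorphism between p-open subgroups is carried by a total function;
   its values outside the domain are irrelevant, since germ_eq ignores them. *)
Record p_iso (p : nat) (F : groupType) := PIso {
  pdom : set F;
  pcod : set F;
  pfun :> F -> F;
  pdom_open : p_open p pdom;
  pcod_open : p_open p pcod;
  pfunM : {in pdom &, {morph pfun : x y / x * y}};
  pfun_bij : set_bij pdom pcod pfun }.

HB.instance Definition _ p F := gen_eqMixin (p_iso p F).
HB.instance Definition _ p F := gen_choiceMixin (p_iso p F).

Definition germ_eq (p : nat) (F : groupType) (f g : p_iso p F) : bool :=
  `[< exists W : set F,
        [/\ p_open p W, W `<=` pdom f, W `<=` pdom g & {in W, f =1 g}] >].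

Lemma is_subgroupP (G : groupType) (H : set G) :
  is_subgroup H <-> H 1 /\ forall x y, H x -> H y -> H (x / y).
Proof.
split=> -[H1 HF]; split.
- by move: H1; rewrite !inE.
- move=> x y Hx Hy; have := HF x y; rewrite !inE; exact.
- by rewrite !inE.
- by move=> x y; rewrite !inE; apply: HF.
Qed.

Lemma is_subgroup1 (G : groupType) (H : set G) : is_subgroup H -> H 1.
Proof. by case/is_subgroupP. Qed.

Lemma is_subgroupF (G : groupType) (H : set G) (x y : G) :
  is_subgroup H -> H x -> H y -> H (x / y).
Proof. by case/is_subgroupP => _; apply. Qed.

Lemma is_subgroupV (G : groupType) (H : set G) (x : G) :
  is_subgroup H -> H x -> H x^-1.
Proof. by move=> sH Hx; rewrite -div1g; exact: is_subgroupF sH (is_subgroup1 sH) Hx. Qed.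

Lemma is_subgroupM (G : groupType) (H : set G) (x y : G) :
  is_subgroup H -> H x -> H y -> H (x * y).
Proof.
by move=> sH Hx Hy; rewrite -[y]invgK; apply: is_subgroupF => //; apply: is_subgroupV.
Qed.

Lemma is_subgroupX (G : groupType) (H : set G) (x : G) (n : nat) :
  is_subgroup H -> H x -> H (x ^+ n).
Proof.
move=> sH Hx; elim: n => [|n IH]; first by rewrite expg0; apply: is_subgroup1.
by rewrite expgS; apply: is_subgroupM.
Qed.

Lemma eq_left_coset (G : groupType) (N : set G) (x y : G) : is_subgroup N ->
  [set x * z | z in N] = [set y * z | z in N] <-> N (x^-1 * y).
Proof.
move=> sN; split=> [E|Nxy].
  have: [set y * z | z in N] y by exists 1; rewrite ?mulg1 //; apply: is_subgroup1.
  by rewrite -E => -[z Nz <-]; rewrite mulKg.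
apply/seteqP; split=> _ [z Nz <-].
  exists ((x^-1 * y)^-1 * z); last by rewrite invgM invgK !mulgA mulgV mul1g.
  by apply: is_subgroupM => //; apply: is_subgroupV.
exists (x^-1 * y * z); last by rewrite !mulgA mulgV mul1g.
exact: is_subgroupM.
Qed.

Lemma left_coset_reps (G : groupType) (N : set G) (n : nat) :
  is_subgroup N -> left_cosets N #= `I_n ->
  exists (idx : G -> 'I_n) (t : 'I_n -> G),
    cancel t idx /\ forall x y, idx x = idx y <-> N (x^-1 * y).
Proof.
move=> sN /card_set_bijP[f [fI finj fsurj]].
have fI' (x : G) : (f [set (x * z)%g | z in N] < n)%N by apply: fI; exists x.
pose idx (x : G) := Ordinal (fI' x).
have idxP x y : idx x = idx y <-> N (x^-1 * y).
  rewrite -(eq_left_coset x y sN); split=> [/(congr1 val) /= E|E].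
    by apply: finj => //; rewrite inE; [exists x|exists y].
  by apply: val_inj => /=; rewrite E.
have /choice[t tP] : forall i, exists x, idx x = i.
  move=> i; have [_ [x _ <-] E] := fsurj i (ltn_ord i).
  by exists x; apply: val_inj.
by exists idx, t.
Qed.

Lemma normal_quotient_perm (G : groupType) (N : set G) (n : nat) :
  is_normal N -> left_cosets N #= `I_n ->
  exists (q : G -> {perm 'I_n}) (Q : {group {perm 'I_n}}),
    [/\ {morph q : x y / x * y}, forall x, q x = 1 <-> N x,
        forall u, u \in Q <-> (exists x, q x = u) & #|Q| = n].
Proof.
move=> [sN nN] cN; have [idx [t [tK idxP]]] := left_coset_reps sN cN.
have tidx x : N ((t (idx x))^-1 * x) by apply/idxP; rewrite tK.
have inj x : injective (fun i => idx (t i * x)).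
  move=> i j /idxP H; rewrite -(tK i) -(tK j); apply/idxP.
  move: (nN _ x^-1 H); rewrite /conjg invgM invgK !mulgA mulgV mul1g.
  by rewrite mulgK.
pose q x := perm (@inj x).
have qM : {morph q : x y / x * y}.
  move=> x y; apply/permP => i; rewrite permM !permE; apply/idxP.
  have := nN _ y (is_subgroupV sN (tidx (t i * x))).
  by rewrite /conjg !invgM !invgK !mulgA.
have q1 x : q x = 1 <-> N x.
  split=> [E|Nx].
    have : q x (idx 1) = idx 1 by rewrite E perm1.
    rewrite permE => /idxP; set s := t _ => H.
    have Ns : N s by have /(is_subgroupV sN) := tidx 1; rewrite mulg1 invgK.
    move: (is_subgroupV sN H); rewrite mulg1 invgK => /(is_subgroupM sN (is_subgroupV sN Ns)).
    by rewrite mulKg.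
  apply/permP => i; rewrite permE perm1 -[RHS]tK; apply/idxP.
  by rewrite invgM mulgVK; apply: is_subgroupV.
have qV x : q x^-1 = (q x)^-1.
  by apply: (mulgI (q x)); rewrite mulgV -qM mulgV; apply/q1; apply: is_subgroup1.
have qt x : q (t (idx x)) = q x.
  apply: (mulgI (q (t (idx x)))^-1); rewrite mulVg -qV -qM.
  by apply/esym/q1.
pose A := [set q (t i) | i : 'I_n]%SET.
have AP u : reflect (exists x, q x = u) (u \in A).
  apply: (iffP imsetP) => [[i _ ->]|[x <-]]; first by exists (t i).
  by exists (idx x).
have gA : group_set A.
  apply/group_setP; split; first by apply/AP; exists 1; apply/q1; apply: is_subgroup1.
  by move=> _ _ /AP[x <-] /AP[y <-]; apply/AP; exists (x * y).
exists q, (Group gA); split=> //=; first by move=> u; split=> /AP.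
rewrite card_imset ?card_ord // => i j E; rewrite -(tK i) -(tK j).
by apply/idxP/q1; rewrite qM qV E mulVg.
Qed.

Lemma morph_expg (G : groupType) (T : finGroupType) (q : G -> T) :
  {morph q : x y / x * y} -> forall x n, q (x ^+ n) = q x ^+ n.
Proof.
move=> qM x; have q1 : q 1 = 1 by apply: (mulgI (q 1)); rewrite -qM !mulg1.
by elim=> [|n IH]; rewrite ?expg0 ?q1 // !expgS qM IH.
Qed.

Lemma normal_index_expg (G : groupType) (N : set G) (n : nat) (x : G) :
  is_normal N -> left_cosets N #= `I_n -> N (x ^+ n).
Proof.
move=> nN cN; have [q [Q [qM q1 QP cQ]]] := normal_quotient_perm nN cN.
have : q x ^+ #|Q| = 1 by apply: expg_cardG; apply/QP; exists x.
by rewrite -morph_expg // cQ => /q1.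
Qed.

Lemma expg_index_pnat (pi : nat_pred) (G : groupType) (N : set G) (n e : nat) :
  is_normal N -> left_cosets N #= `I_n -> pi.-nat e ->
  (forall x, N (x ^+ e)) -> pi.-nat n.
Proof.
move=> nN cN pe Ne; have [q [Q [qM q1 QP cQ]]] := normal_quotient_perm nN cN.
suff: pi.-nat #|Q| by rewrite cQ.
rewrite -[pi.-nat _]/(pi.-group Q) -pnat_exponent; apply: pnat_dvd pe.
by apply/exponentP => _ /QP[x <-]; rewrite -morph_expg //; apply/q1.
Qed.

Lemma p_iso_fun (p : nat) (F : groupType) (f : p_iso p F) x : pdom f x -> pcod f (f x).
Proof. by case: (pfun_bij f) => h _ _; apply: h. Qed.

Lemma p_iso_inj (p : nat) (F : groupType) (f : p_iso p F) x y :
  pdom f x -> pdom f y -> f x = f y -> x = y.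
Proof. by case: (pfun_bij f) => _ h _ ? ?; apply: h; rewrite inE. Qed.

Lemma p_iso_surj (p : nat) (F : groupType) (f : p_iso p F) y :
  pcod f y -> exists2 x, pdom f x & f x = y.
Proof. by case: (pfun_bij f) => _ _; apply. Qed.

Lemma p_isoM (p : nat) (F : groupType) (f : p_iso p F) x y :
  pdom f x -> pdom f y -> f (x * y) = f x * f y.
Proof. by move=> *; apply: pfunM; rewrite inE. Qed.

Lemma pdom_sub (p : nat) (F : groupType) (f : p_iso p F) : is_subgroup (pdom f).
Proof. by case: (pdom_open f). Qed.

Lemma p_iso1 (p : nat) (F : groupType) (f : p_iso p F) : f 1 = 1.
Proof.
have d1 := is_subgroup1 (pdom_sub f).
by apply: (mulgI (f 1)); rewrite -p_isoM // !mulg1.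
Qed.

Lemma p_isoV (p : nat) (F : groupType) (f : p_iso p F) x :
  pdom f x -> f x^-1 = (f x)^-1.
Proof.
move=> dx; have dV := is_subgroupV (pdom_sub f) dx.
by apply: (mulgI (f x)); rewrite mulgV -p_isoM // mulgV p_iso1.
Qed.

Lemma p_isoX (p : nat) (F : groupType) (f : p_iso p F) x n :
  pdom f x -> f (x ^+ n) = f x ^+ n.
Proof.
move=> dx; elim: n => [|n IH]; first by rewrite !expg0 p_iso1.
by rewrite !expgS p_isoM ?IH //; apply: is_subgroupX => //; apply: pdom_sub.
Qed.

Lemma p_open_preim (p : nat) (F : groupType) (f : p_iso p F) (W : set F) :
  p_open p W -> p_open p [set x | pdom f x /\ W (f x)].
Proof.
move=> [sW [N [m [nN NW cN pm]]]].
have [sU [K [n [nK KU cK pn]]]] := pdom_open f.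
have [sN JN] := nN; have [sK JK] := nK; split.
  apply/is_subgroupP; split=> /=.
    by rewrite p_iso1; split; apply: is_subgroup1.
  move=> x y [Ux Wx] [Uy Wy]; split; first exact: is_subgroupF.
  rewrite p_isoM ?p_isoV //; last exact: is_subgroupV.
  exact: is_subgroupF.
pose L := [set x | K x /\ forall y, N (f (x ^ y))].
have nL : is_normal L.
  split; last first.
    by move=> x y [Kx Nx]; split; [apply: JK|move=> z; rewrite -conjgM].
  apply/is_subgroupP; split.
    by split; [apply: is_subgroup1|move=> y; rewrite conj1g p_iso1; apply: is_subgroup1].
  move=> x y [Kx Nx] [Ky Ny]; split; first exact: is_subgroupF.
  move=> z; rewrite conjMg conjVg p_isoM ?p_isoV; [exact: is_subgroupF|..];
    by do ?[apply: is_subgroupV => //]; apply: KU; apply: JK.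
have [idxK [t [tK idxKP]]] := left_coset_reps sK cK.
have [idxN [s [sK' idxNP]]] := left_coset_reps sN cN.
have Kt x : K ((t (idxK x))^-1 * x) by apply/idxKP; rewrite tK.
have fin : finite_set (left_cosets L).
  pose Phi x := (idxK x, [ffun i => idxN (f (((t (idxK x))^-1 * x) ^ t i))]).
  have PhiP x y : Phi x = Phi y -> L (x^-1 * y).
    move=> [Exy /ffunP E]; move: (Kt x) (Kt y) E; rewrite -Exy.
    set u := _ * x; set v := _ * y => Ku Kv E.
    have -> : x^-1 * y = u^-1 * v by rewrite /u /v invgM invgK mulgA mulgK.
    clearbody u v => {Exy}.
    have Kuv : K (u^-1 * v) by apply: is_subgroupM => //; apply: is_subgroupV.
    split=> // z; have := Kt z; set w := (t _)^-1 * z => Kw.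
    have -> : z = t (idxK z) * w by rewrite mulVKg.
    clearbody w.
    set a := t (idxK z).
    have Ua c : K c -> pdom f (c ^ a) by move=> ?; apply: KU; apply: JK.
    have Nuv : N (f ((u^-1 * v) ^ a)).
      have := E (idxK z); rewrite !ffunE => /idxNP.
      have Uu := Ua _ Ku; have Uv := Ua _ Kv; have UuV := is_subgroupV sU Uu.
      by rewrite conjMg conjVg (p_isoM UuV Uv) (p_isoV Uu).
    have Uw := KU _ Kw; have UwV := is_subgroupV sU Uw.
    have Uc := Ua _ Kuv; have Ucw := is_subgroupM sU Uc Uw.
    by rewrite conjgM [_ ^ w]conjgE (p_isoM UwV Ucw) (p_isoV Uw) (p_isoM Uc Uw); apply: JN.
  pose psi (c : 'I_n * {ffun 'I_n -> 'I_m}) := [set xget 1 [set x | Phi x = c] * y | y in L].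
  apply: (@sub_finite_set _ _ (psi @` [set: _])); last exact/finite_image/finite_finset.
  move=> _ [x _ <-]; exists (Phi x) => //.
  apply/eq_left_coset; first by case: nL.
  by apply: PhiP; apply: (xgetPex 1 (P := [set z | Phi z = Phi x])); exists x.
have [l cL] := (finite_setP _).1 fin.
exists L, l; split=> //.
  move=> x [Kx Nx]; split; first exact: KU.
  by apply: NW; have := Nx 1; rewrite conjg1.
apply: (@expg_index_pnat _ _ _ _ (n * m) nL cL); first by rewrite pnatM pn.
move=> x; have Kxn y : K (y ^+ n) by apply: normal_index_expg.
rewrite expgnA; split; first exact: is_subgroupX.
move=> y; rewrite conjXg conjXg p_isoX; first exact: normal_index_expg.
exact: KU.
Qed.

Lemma p_openT (p : nat) (F : groupType) : p_open p [set: F].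
Proof.
have sT : is_subgroup [set: F] by apply/is_subgroupP.
split=> //; exists setT, 1%N; split=> //.
have -> : left_cosets [set: F] = [set [set: F]].
  apply/seteqP; split=> [_ [x _ <-]|_ ->] /=.
    by apply/seteqP; split=> // y _; exists (x^-1 * y) => //; rewrite mulVKg.
  by exists 1 => //; apply/seteqP; split=> // y _; exists y => //; rewrite mul1g.
apply/card_set_bijP; exists (fun=> 0%N); split=> //.
  by move=> A B; rewrite !inE => -> ->.
by case=> // _; exists setT.
Qed.

Fact p_iso_idM (F : groupType) : {in [set: F] &, {morph id : x y / x * y}}.
Proof. by []. Qed.

Fact p_iso_id_bij (F : groupType) : set_bij [set: F] [set: F] id.
Proof. by split=> // y _; exists y. Qed.

Definition p_iso_id (p : nat) (F : groupType) : p_iso p F :=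
  PIso (p_openT p F) (p_openT p F) (@p_iso_idM F) (@p_iso_id_bij F).

Definition p_iso_invfun (p : nat) (F : groupType) (f : p_iso p F) (y : F) : F :=
  xget 1 [set x | pdom f x /\ f x = y].

Lemma p_iso_invfunK (p : nat) (F : groupType) (f : p_iso p F) (x : F) :
  pdom f x -> p_iso_invfun f (f x) = x.
Proof.
move=> dx; rewrite /p_iso_invfun; case: xgetP => [y _ [dy E]|/(_ x)]; last by case.
exact: p_iso_inj E.
Qed.

Fact p_iso_invM (p : nat) (F : groupType) (f : p_iso p F) :
  {in pcod f &, {morph p_iso_invfun f : x y / x * y}}.
Proof.
move=> x y; rewrite !inE => /p_iso_surj[a da <-] /p_iso_surj[b db <-].
rewrite -p_isoM // !p_iso_invfunK //.
by apply: is_subgroupM => //; apply: pdom_sub.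
Qed.

Fact p_iso_inv_bij (p : nat) (F : groupType) (f : p_iso p F) :
  set_bij (pcod f) (pdom f) (p_iso_invfun f).
Proof.
split.
- by move=> _ /p_iso_surj[a da <-]; rewrite p_iso_invfunK.
- move=> x y; rewrite !inE => /p_iso_surj[a da <-] /p_iso_surj[b db <-].
  by rewrite !p_iso_invfunK // => ->.
- by move=> x dx; exists (f x); [apply: p_iso_fun|apply: p_iso_invfunK].
Qed.

Definition p_iso_inv (p : nat) (F : groupType) (f : p_iso p F) : p_iso p F :=
  PIso (pcod_open f) (pdom_open f) (p_iso_invM (f := f)) (p_iso_inv_bij f).

Definition comp_dom (p : nat) (F : groupType) (f g : p_iso p F) : set F :=
  [set x | pdom g x /\ pdom f (g x)].

Fact comp_dom_open (p : nat) (F : groupType) (f g : p_iso p F) :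
  p_open p (comp_dom f g).
Proof. exact/p_open_preim/pdom_open. Qed.

Fact comp_cod_open (p : nat) (F : groupType) (f g : p_iso p F) :
  p_open p [set f (g x) | x in comp_dom f g].
Proof.
suff -> : [set f (g x) | x in comp_dom f g] =
    [set z | pcod f z /\ pcod g (p_iso_inv f z)].
  exact/(p_open_preim (p_iso_inv f))/pcod_open.
apply/seteqP; split=> [_ [x [dgx dfgx] <-]|z [/p_iso_surj[y dy <-]]] /=.
  by rewrite p_iso_invfunK //; split; apply: p_iso_fun.
by rewrite p_iso_invfunK // => /p_iso_surj[x dx E]; exists x; rewrite /comp_dom /= E.
Qed.

Fact p_iso_compM (p : nat) (F : groupType) (f g : p_iso p F) :
  {in comp_dom f g &, {morph f \o g : x y / x * y}}.
Proof.
by move=> x y; rewrite !inE => -[? ?] [? ?] /=; rewrite !p_isoM.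
Qed.

Fact p_iso_comp_bij (p : nat) (F : groupType) (f g : p_iso p F) :
  set_bij (comp_dom f g) [set f (g x) | x in comp_dom f g] (f \o g).
Proof.
split=> [x dx|x y|z [x dx <-]]; [by exists x| |by exists x].
rewrite !inE => -[dx dgx] [dy dgy] /= /(p_iso_inj dgx dgy).
exact: p_iso_inj.
Qed.

Definition p_iso_comp (p : nat) (F : groupType) (f g : p_iso p F) : p_iso p F :=
  PIso (comp_dom_open f g) (comp_cod_open f g)
    (p_iso_compM (f := f) (g := g)) (p_iso_comp_bij f g).

Lemma germ_eqP (p : nat) (F : groupType) (f g : p_iso p F) :
  reflect (exists W : set F,
    [/\ p_open p W, W `<=` pdom f, W `<=` pdom g & forall x, W x -> f x = g x])
    (germ_eq f g).
Proof.
rewrite /germ_eq; apply: (iffP (asboolP _)) => -[W [oW Wf Wg E]]; exists W; split=> // x.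
  by move=> Wx; apply: E; rewrite inE.
by rewrite inE; apply: E.
Qed.

Fact germ_eq_refl (p : nat) (F : groupType) : reflexive (@germ_eq p F).
Proof. by move=> f; apply/germ_eqP; exists (pdom f); split=> //; apply: pdom_open. Qed.

Lemma p_openI (p : nat) (F : groupType) (U V : set F) :
  p_open p U -> p_open p V -> p_open p (U `&` V).
Proof.
move=> oU oV.
have idM : {in U &, {morph id : x y / x * y}} by [].
have id_bij : set_bij U U id by split=> // y Uy; exists y.
exact: (p_open_preim (PIso oU oU idM id_bij) oV).
Qed.

Fact germ_eq_sym (p : nat) (F : groupType) : symmetric (@germ_eq p F).
Proof.
suff h f g : @germ_eq p F f g -> germ_eq g f by move=> f g; apply/idP/idP; apply: h.
move=> /germ_eqP[W [oW Wf Wg E]]; apply/germ_eqP; exists W; split=> // x Wx.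
by rewrite E.
Qed.

Fact germ_eq_trans (p : nat) (F : groupType) : transitive (@germ_eq p F).
Proof.
move=> g f h /germ_eqP[W [oW Wf Wg E]] /germ_eqP[W' [oW' Wg' Wh' E']].
apply/germ_eqP; exists (W `&` W'); split; first exact: p_openI.
- by move=> x [/Wf].
- by move=> x [_ /Wh'].
- by move=> x [Wx W'x]; rewrite E // E'.
Qed.

Canonical germ_equiv (p : nat) (F : groupType) : equiv_rel (p_iso p F) :=
  EquivRel (@germ_eq p F) (@germ_eq_refl p F) (@germ_eq_sym p F)
    (@germ_eq_trans p F).

Definition Comm (p : nat) (F : groupType) : Type := {eq_quot germ_equiv p F}.

HB.instance Definition _ p F := Choice.on (Comm p F).
HB.instance Definition _ p F := EqQuotient.on (Comm p F).

Definition germ (p : nat) (F : groupType) (f : p_iso p F) : Comm p F :=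
  \pi_(Comm p F) f.

Definition Comm_one (p : nat) (F : groupType) : Comm p F := germ (p_iso_id p F).

Definition Comm_inv (p : nat) (F : groupType) (a : Comm p F) : Comm p F :=
  germ (p_iso_inv (repr a)).

Definition Comm_mul (p : nat) (F : groupType) (a b : Comm p F) : Comm p F :=
  germ (p_iso_comp (repr a) (repr b)).

Lemma germP (p : nat) (F : groupType) (f g : p_iso p F) :
  germ f = germ g <-> germ_eq f g.
Proof. by split=> [/eqmodP|H]; [|apply/eqmodP]. Qed.

Lemma germ_repr (p : nat) (F : groupType) (a : Comm p F) : germ (repr a) = a.
Proof. exact: reprK. Qed.

Lemma germ_mul (p : nat) (F : groupType) (f g : p_iso p F) :
  Comm_mul (germ f) (germ g) = germ (p_iso_comp f g).
Proof.
apply/germP.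
have /germP/germ_eqP[V [oV Vf' Vf Ef]] := germ_repr (germ f).
have /germP/germ_eqP[W [oW Wg' Wg Eg]] := germ_repr (germ g).
apply/germ_eqP; exists (W `&` [set x | pdom g x /\ V (g x)]); split.
- exact/p_openI/p_open_preim.
- by move=> x [Wx [_ Vgx]]; split; [apply: Wg'|rewrite Eg //; apply: Vf'].
- by move=> x [Wx [dx Vgx]]; split=> //; apply: Vf.
- by move=> x [Wx [dx Vgx]] /=; rewrite Eg // Ef.
Qed.

Lemma germ_inv (p : nat) (F : groupType) (f : p_iso p F) :
  Comm_inv (germ f) = germ (p_iso_inv f).
Proof.
apply/germP.
have /germP/germ_eqP[V [oV Vf' Vf Ef]] := germ_repr (germ f).
set f' := repr _ in Vf' Ef *.
have E z : pcod f z /\ V (p_iso_inv f z) ->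
    pcod f' z /\ p_iso_inv f' z = p_iso_inv f z.
  move=> -[/p_iso_surj[x dx <-]] /=; rewrite p_iso_invfunK // => Vx.
  rewrite -Ef // p_iso_invfunK; last exact: Vf'.
  by split=> //; apply/p_iso_fun/Vf'.
apply/germ_eqP; exists [set z | pcod f z /\ V (p_iso_inv f z)]; split.
- exact: (p_open_preim (p_iso_inv f)).
- by move=> z /E[].
- by move=> z [].
- by move=> z /E[].
Qed.

Fact Comm_mulA (p : nat) (F : groupType) : associative (@Comm_mul p F).
Proof.
move=> a b c; rewrite -(germ_repr a) -(germ_repr b) -(germ_repr c) !germ_mul.
set f := repr a; set g := repr b; set h := repr c.
apply/germP/germ_eqP; exists (comp_dom f (p_iso_comp g h)); split=> //.
- exact: comp_dom_open.
- by move=> x [[dx dhx] dghx].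
Qed.

Fact Comm_mul1 (p : nat) (F : groupType) : left_id (Comm_one p F) (@Comm_mul p F).
Proof.
move=> a; rewrite -(germ_repr a) germ_mul.
apply/germP/germ_eqP; exists (pdom (repr a)); split=> //.
exact: pdom_open.
Qed.

Fact Comm_mulr1 (p : nat) (F : groupType) : right_id (Comm_one p F) (@Comm_mul p F).
Proof.
move=> a; rewrite -(germ_repr a) germ_mul.
apply/germP/germ_eqP; exists (pdom (repr a)); split=> //.
exact: pdom_open.
Qed.

Fact Comm_mulV (p : nat) (F : groupType) :
  left_inverse (Comm_one p F) (@Comm_inv p F) (@Comm_mul p F).
Proof.
move=> a; rewrite -(germ_repr a) germ_inv germ_mul.
apply/germP/germ_eqP; exists (pdom (repr a)); split=> //.
- exact: pdom_open.
- by move=> x dx; split=> //; apply: p_iso_fun.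
- by move=> x dx /=; rewrite p_iso_invfunK.
Qed.

Fact Comm_mulrV (p : nat) (F : groupType) :
  right_inverse (Comm_one p F) (@Comm_inv p F) (@Comm_mul p F).
Proof.
move=> a; rewrite -(germ_repr a) germ_inv germ_mul.
have dV z : pcod (repr a) z -> pdom (repr a) (p_iso_inv (repr a) z).
  by case: (p_iso_inv_bij (repr a)) => h _ _; apply: h.
apply/germP/germ_eqP; exists (pcod (repr a)); split=> //.
- exact: pcod_open.
- by move=> z cz; split=> //; apply: dV.
- by move=> _ /p_iso_surj[x dx <-] /=; rewrite p_iso_invfunK.
Qed.

HB.instance Definition _ (p : nat) (F : groupType) :=
  isGroup.Build (Comm p F) (@Comm_mulA p F) (@Comm_mul1 p F) (@Comm_mulr1 p F)
    (@Comm_mulV p F) (@Comm_mulrV p F).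

Lemma germM (p : nat) (F : groupType) (f g : p_iso p F) :
  germ f * germ g = germ (p_iso_comp f g).
Proof. exact: germ_mul. Qed.

(* [ab] induces an isomorphism from H/[H,H] onto Z^r. *)
Definition is_abelianization (F : groupType) (H : set F) (r : nat)
    (ab : F -> 'rV[int]_r) : Prop :=
  [/\ forall x y, H x -> H y -> ab (x * y) = (ab x + ab y)%R,
      forall v, exists2 x, H x & ab x = v
    & forall x, H x -> (ab x = 0%R <-> derived_subgroup H x)].

(* Vectors are rows, so the matrix A of the automorphism that phi induces on
   H/[H,H] acts on the right; its determinant does not depend on [ab]. *)
Definition acts_by_SL (F : groupType) (H : set F) (phi : F -> F) : Prop :=
  exists (r : nat) (ab : F -> 'rV[int]_r) (A : 'M[int]_r),
    [/\ is_abelianization H ab,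
        forall x, H x -> ab (phi x) = (ab x *m A)%R
      & (\det A)%R = 1%R].

Definition SAut (p : nat) (F : groupType) (H : set F) : set (Comm p F) :=
  [set germ f | f in [set f : p_iso p F |
     [/\ pdom f = H, pcod f = H & acts_by_SL H f]]].

Arguments SAut p {F} H.

Definition SComm (p : nat) (F : groupType) : set (Comm p F) :=
  subgroup_generated (\bigcup_(H in @p_open p F) SAut p H).

Arguments SComm p F : clear implicits.

(* Main.v *)
Require Import Defs.
From HB Require Import structures.
From mathcomp Require Import all_boot all_order all_algebra fingroup perm.
From mathcomp Require Import quotient morphism cyclic pgroup gseries maximal.
From mathcomp Require Import boolp classical_sets functions cardinality.
From mathcomp Require Import zify.

Set Implicit Arguments.
Unset Strict Implicit.
Unset Printing Implicit Defensive.

Local Open Scope classical_set_scope.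
Local Open Scope group_scope.

(** A germ [s <> 1] moves some [x], and then [s] times a conjugate of its inverse is the
    inner germ of [phi x * x^-1]; so a normal subgroup [S] contains the inner germ of some
    [y <> 1].  The proof enlarges [S] in three steps.

    From one inner germ to Nielsen moves ([inner_good]).  Let [X] be a basis of an
    open subgroup in which [y] has exponent sum prime to [p] in one basis element [x] and
    avoids three others.  In the kernel of the map to [Z/p] sending [x] to [1], the
    element [y] acts on the Schreier basis by a shift of the sheets, up to
    conjugations that involve none of the three elements.  The commutator of [y] with a
    Nielsen move supported on one sheet is therefore a product of two moves with
    disjoint supports, and one more commutator isolates a single Nielsen move.  A single
    one gives all of them ([one_move_good]), by conjugating with signed
    permutations of determinant one.  General position is reached in [open_inner]: a
    commutator has vanishing exponent sums, so it lies in a cyclic cover of large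
    degree, whose rank exceeds its length; from there [descend] passes to
    kernels of the leading letter, which shortens the word each time, until
    some exponent sum is prime to [p].

    From one basis to all bases ([all_good]).  Once the moves of one basis come
    from [S], so do the inner automorphisms of the subgroup it generates.  Hence for any
    basis [X] of any open subgroup and any [x] in [X] the inner germ of some power
    [x^q] lies in [S].  This power is a basis element of the cyclic cover of degree
    [q], to which the first step applies.  The move [x |-> a x] preserves the
    cover and acts on its Schreier basis by Whitehead moves ([nequiv_cover_none]),
    so its germ lies in [S].

    From moves to special automorphisms ([nielsen_det1]).  Nielsen's theorem, proved by
    folding graphs, turns the image of a basis into a signed permutation of it by
    Nielsen moves; determinant one removes the remaining sign.  Every open
    subgroup has a finite basis ([open_basis]), so this covers all generators of [SComm].

    Freeness is expressed by words, and a germ by the images of a basis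
    ([carries]), so that an identity between germs is checked on the basis. *)

(** * Words and free families *)

(** A letter is a variable or, with the mark [true], its inverse. *)
Notation letter I := (I * bool)%type.
Notation word I := (seq (letter I)).

Definition sgn (G : groupType) (b : bool) (g : G) : G := if b then g^-1 else g.

Definition ev (I : Type) (G : groupType) (X : I -> G) (w : word I) : G :=
  foldr (fun l g => sgn l.2 (X l.1) * g) 1 w.

Definition flip (I : Type) (l : letter I) : letter I := (l.1, ~~ l.2).
Definition winv (I : Type) (w : word I) : word I := rev (map (@flip I) w).
Definition wsgn (I : Type) (b : bool) (w : word I) := if b then winv w else w.
Definition wsubst (I J : Type) (a : I -> word J) (w : word I) : word J :=
  flatten [seq wsgn l.2 (a l.1) | l <- w].

Section Words.
Variables (I : Type) (G : groupType).
Implicit Types (X Y : I -> G) (w : word I).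

Lemma sgnV b (g : G) : sgn (~~ b) g = (sgn b g)^-1.
Proof. by case: b; rewrite /= ?invgK. Qed.

Lemma sgnK b (g : G) : sgn b (sgn b g) = g.
Proof. by case: b; rewrite /= ?invgK. Qed.

Lemma sgnJ b (g h : G) : sgn b (g ^ h) = sgn b g ^ h.
Proof. by case: b; rewrite /= ?conjVg. Qed.

Lemma sgnD b c (g : G) : sgn b (sgn c g) = sgn (b (+) c) g.
Proof. by case: b c => [] []; rewrite /= ?invgK. Qed.

Lemma ev_cons X l w : ev X (l :: w) = sgn l.2 (X l.1) * ev X w.
Proof. by []. Qed.

Lemma ev_cat X w1 w2 : ev X (w1 ++ w2) = ev X w1 * ev X w2.
Proof. by elim: w1 => [|l w1 IH] /=; rewrite ?mul1g // IH mulgA. Qed.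

Lemma ev1 X l : ev X [:: l] = sgn l.2 (X l.1).
Proof. by rewrite /= mulg1. Qed.

Lemma ev_rcons X w l : ev X (rcons w l) = ev X w * sgn l.2 (X l.1).
Proof. by rewrite -cats1 ev_cat ev1. Qed.

Lemma ev_winv X w : ev X (winv w) = (ev X w)^-1.
Proof.
elim: w => [|l w IH]; first by rewrite /= invg1.
by rewrite /winv map_cons rev_cons ev_rcons ev_cons -/(winv w) IH invgM sgnV.
Qed.

Lemma ev_wsgn X b w : ev X (wsgn b w) = sgn b (ev X w).
Proof. by case: b; rewrite //= ev_winv. Qed.

Lemma eq_ev X Y : X =1 Y -> ev X =1 ev Y.
Proof. by move=> E; elim=> //= l w ->; rewrite E. Qed.

Lemma flipK : involutive (@flip I).
Proof. by case=> i b; rewrite /flip /= negbK. Qed.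

End Words.

Lemma ev_subst (I J : Type) (G : groupType) (X : J -> G) (a : I -> word J) w :
  ev X (wsubst a w) = ev (fun i => ev X (a i)) w.
Proof. by elim: w => //= l w IH; rewrite /wsubst /= ev_cat ev_wsgn -IH. Qed.

(** The generated subgroup, presented by words because rewriting acts on them. *)
Definition hull (I : Type) (G : groupType) (X : I -> G) : set G :=
  [set ev X w | w in [set: word I]].

(** Freeness is phrased through words so that it only speaks of the family and
    not of an ambient group. *)
Definition is_free (I : Type) (G : groupType) (X : I -> G) : Prop :=
  forall (K : groupType) (f : I -> K) w, ev X w = 1 -> ev f w = 1.

Section Hull.
Variables (I : Type) (G : groupType).
Implicit Types X Y : I -> G.

Lemma hull_ev X w : hull X (ev X w).
Proof. by exists w. Qed.

Lemma hull_gen X i : hull X (X i).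
Proof. by exists [:: (i, false)]; rewrite //= mulg1. Qed.

Lemma hull_sub X : is_subgroup (hull X).
Proof.
apply/is_subgroupP; split; first by exists [::].
move=> _ _ [v _ <-] [w _ <-]; exists (v ++ winv w) => //.
by rewrite ev_cat ev_winv.
Qed.

Lemma sgn_sub (H : set G) b g : is_subgroup H -> H g -> H (sgn b g).
Proof. by case: b => //= sH; apply: is_subgroupV. Qed.

Lemma ev_sub (H : set G) X w : is_subgroup H -> (forall i, H (X i)) -> H (ev X w).
Proof.
move=> sH HX; elim: w => [|l w IH] /=; first exact: is_subgroup1.
by apply: is_subgroupM => //; apply: sgn_sub.
Qed.

Lemma hull_min (H : set G) X : is_subgroup H -> (forall i, H (X i)) -> hull X `<=` H.
Proof. by move=> sH HX _ [w _ <-]; apply: ev_sub. Qed.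

End Hull.

Lemma hull_eq (I J : Type) (G : groupType) (X : I -> G) (Y : J -> G) :
  (forall i, hull Y (X i)) -> (forall j, hull X (Y j)) -> hull X = hull Y.
Proof. by move=> h1 h2; apply/seteqP; split; apply: hull_min => //; apply: hull_sub. Qed.

Lemma morph_ev (I : Type) (G K : groupType) (H : set G) (h : G -> K) (X : I -> G) w :
  is_subgroup H -> (forall x y, H x -> H y -> h (x * y) = h x * h y) ->
  (forall i, H (X i)) -> h (ev X w) = ev (h \o X) w.
Proof.
move=> sH hM HX.
have h1 : h 1 = 1 by apply: (mulgI (h 1)); rewrite -hM ?mulg1 //; apply: is_subgroup1.
have hV x : H x -> h x^-1 = (h x)^-1.
  by move=> Hx; apply: (mulgI (h x)); rewrite -hM ?mulgV //; apply: is_subgroupV.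
elim: w => [|[i b] w IH] //=; rewrite hM; [|exact: sgn_sub|exact: ev_sub].
by rewrite IH; case: b => //=; rewrite hV.
Qed.

Section Ehom.
Variables (I : choiceType) (G : groupType) (X : I -> G).

Definition word_of (g : G) : word I := xget [::] [set w | ev X w = g].

Lemma word_ofK g : hull X g -> ev X (word_of g) = g.
Proof. by case=> w _ E; apply: (xgetPex [::] (P := [set w | ev X w = g])); exists w. Qed.

Definition ehom (K : groupType) (f : I -> K) (g : G) : K := ev f (word_of g).

Hypothesis fX : is_free X.

Lemma free_eq (K : groupType) (f : I -> K) v w : ev X v = ev X w -> ev f v = ev f w.
Proof.
move=> E; have /(@fX K f) : ev X (v ++ winv w) = 1 by rewrite ev_cat ev_winv E mulgV.
by rewrite ev_cat ev_winv => /divg1_eq.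
Qed.

Lemma ehomE (K : groupType) (f : I -> K) w : ehom f (ev X w) = ev f w.
Proof. by apply: free_eq; apply/word_ofK/hull_ev. Qed.

Lemma ehom_gen (K : groupType) (f : I -> K) i : ehom f (X i) = f i.
Proof. by have := ehomE f [:: (i, false)]; rewrite /= !mulg1. Qed.

Lemma ehomM (K : groupType) (f : I -> K) x y :
  hull X x -> hull X y -> ehom f (x * y) = ehom f x * ehom f y.
Proof. by move=> [v _ <-] [w _ <-]; rewrite -ev_cat !ehomE ev_cat. Qed.

End Ehom.

(** A relation among the [Y j] is one among the [X i].  It therefore holds for all values
    [f] of the new variables, because these come from values [f'] of the old ones. *)
Lemma free_subst (I J : Type) (G : groupType) (X : I -> G) (a : J -> word I) (Y : J -> G) :
  is_free X -> (forall j, Y j = ev X (a j)) ->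
  (forall (K : groupType) (f : J -> K), exists f' : I -> K, forall j, f j = ev f' (a j)) ->
  is_free Y.
Proof.
move=> fX YE h K f w; have [f' fE] := h K f.
rewrite (eq_ev YE) -ev_subst => /fX-/(_ K f').
by rewrite ev_subst -(eq_ev fE).
Qed.

Section SubgroupType.
Variables (G : groupType) (H : set G) (sH : is_subgroup H).

(** A target for the universal property of a basis, see [free_basis]. *)
Definition subgroup_type of is_subgroup H := {x : G | x \in H}.
Local Notation T := (subgroup_type sH).

HB.instance Definition _ := Choice.on T.

Fact subgroup_type_in (x : G) : H x -> x \in H. Proof. by rewrite inE. Qed.
Fact subgroup_typeP (x : T) : H (val x). Proof. by rewrite -in_setE; apply: (valP x). Qed.

Definition subgroup_mul (x y : T) : T :=
  Sub (val x * val y)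
    (subgroup_type_in (is_subgroupM sH (subgroup_typeP x) (subgroup_typeP y))).
Definition subgroup_one : T := Sub 1 (subgroup_type_in (is_subgroup1 sH)).
Definition subgroup_inv (x : T) : T :=
  Sub (val x)^-1 (subgroup_type_in (is_subgroupV sH (subgroup_typeP x))).

Fact subgroup_mulA : associative subgroup_mul.
Proof. by move=> x y z; apply: val_inj; rewrite /= mulgA. Qed.
Fact subgroup_mul1 : left_id subgroup_one subgroup_mul.
Proof. by move=> x; apply: val_inj; rewrite /= mul1g. Qed.
Fact subgroup_mulr1 : right_id subgroup_one subgroup_mul.
Proof. by move=> x; apply: val_inj; rewrite /= mulg1. Qed.
Fact subgroup_mulV : left_inverse subgroup_one subgroup_inv subgroup_mul.
Proof. by move=> x; apply: val_inj; rewrite /= mulVg. Qed.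
Fact subgroup_mulrV : right_inverse subgroup_one subgroup_inv subgroup_mul.
Proof. by move=> x; apply: val_inj; rewrite /= mulgV. Qed.

HB.instance Definition _ := isGroup.Build T
  subgroup_mulA subgroup_mul1 subgroup_mulr1 subgroup_mulV subgroup_mulrV.

End SubgroupType.

(** A homomorphism to the hull of the basis, followed by the inclusion, fixes the
    basis, so it is the identity: the basis generates. *)
Lemma free_basis (F : groupType) (r : nat) (X : 'I_r -> F) :
  is_free_basis X -> is_free X /\ hull X = [set: F].
Proof.
move=> bX; split.
  move=> K f w E; have [[h hX] _] := bX K f.
  have hM x y : h (x * y) = h x * h y by exact: gmulfM.
  have h1 : h 1 = 1 by apply: (mulgI (h 1)); rewrite -hM !mulg1.
  have := @morph_ev _ _ _ setT h X w (p_openT 2 F).1 (fun x y _ _ => hM x y) (fun=> Logic.I).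
  by rewrite E h1 => ->; apply: eq_ev => i /=; rewrite hX.
pose T := subgroup_type (hull_sub X).
pose x0 i : T := Sub (X i) (subgroup_type_in (hull_gen X i)).
have [[h hX] _] := bX T x0.
have [_ U] := bX F X.
apply/seteqP; split=> // x _.
pose vh y := val (h y).
have vhM : {morph vh : y z / y * z} by move=> y z; rewrite /vh gmulfM.
pose m := isMultiplicative.Build _ _ vh vhM.
pose hv : {multiplicative F -> F} := HB.pack vh m.
have <- : hv x = x by apply: (U hv idfun) => i; rewrite /= /vh hX.
exact: subgroup_typeP.
Qed.

(** * Nielsen moves *)

Section Moves.
Variables (I : finType) (G : groupType).
Implicit Types (X Y Z : I -> G) (i j k : I).

Definition upd Y i g : I -> G := fun k => if k == i then g else Y k.

Definition move Y i j (left b : bool) : I -> G :=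
  upd Y i (if left then sgn b (Y j) * Y i else Y i * sgn b (Y j)).

Inductive nequiv Y : (I -> G) -> Prop :=
| nequiv_refl : nequiv Y Y
| nequiv_move Z i j l b : nequiv Y Z -> i != j -> nequiv Y (move Z i j l b).

Lemma nequiv_trans Y X Z : nequiv X Y -> nequiv Y Z -> nequiv X Z.
Proof. by move=> XY; elim=> // W i j l b _ IH ij; apply: nequiv_move. Qed.

Lemma nequiv1 Y i j l b : i != j -> nequiv Y (move Y i j l b).
Proof. by move=> ij; apply: nequiv_move ij; apply: nequiv_refl. Qed.

Lemma updE Y i g : upd Y i g i = g. Proof. by rewrite /upd eqxx. Qed.

Lemma upd_neq Y i g k : k != i -> upd Y i g k = Y k.
Proof. by rewrite /upd => /negPf->. Qed.

Lemma moveK Y i j l b : i != j -> move (move Y i j l b) i j l (~~ b) = Y.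
Proof.
move=> ij; apply/funext => k; rewrite /move; have [->|ki] := eqVneq k i.
  rewrite !updE [upd _ _ _ j]upd_neq 1?eq_sym //.
  by case: l; rewrite sgnV ?mulKg ?mulgK.
by rewrite !upd_neq.
Qed.

Definition move_word i j (l b : bool) k : word I :=
  if k == i then if l then [:: (j, b); (i, false)] else [:: (i, false); (j, b)]
  else [:: (k, false)].

Lemma moveE (K : groupType) (Y : I -> K) i j l b k :
  (if k == i then if l then sgn b (Y j) * Y i else Y i * sgn b (Y j) else Y k) =
  ev Y (move_word i j l b k).
Proof. by rewrite /move_word; case: eqP => // _; case: l => /=; rewrite ?mulg1. Qed.

Lemma hull_move Y i j l b : i != j -> hull (move Y i j l b) = hull Y.
Proof.
move=> ij; have h (Z : I -> G) c k : hull Z (move Z i j l c k).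
  by rewrite /move /upd moveE; apply: hull_ev.
apply: hull_eq => k; first exact: h.
by rewrite -{2}(moveK Y l b ij); apply: h.
Qed.

End Moves.

Lemma free_move (I : finType) (G : groupType) (Y : I -> G) i j l b :
  i != j -> is_free Y -> is_free (move Y i j l b).
Proof.
move=> ij fY; apply: (free_subst (a := move_word i j l b) fY) => [k|K f].
  by rewrite /move /upd moveE.
exists (move f i j l (~~ b)) => k; rewrite -moveE.
by have := congr1 (@^~ k) (moveK f l (~~ b) ij); rewrite negbK {1}/move /upd => <-.
Qed.

Section NielsenEquivalence.
Variables (I : finType) (G : groupType).
Implicit Types (X Y Z : I -> G) (i j k : I).

Lemma nequiv_hull X Y : nequiv X Y -> hull Y = hull X.
Proof. by elim=> // Z i j l b _ IH ij; rewrite hull_move. Qed.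

Lemma nequiv_free X Y : nequiv X Y -> is_free X -> is_free Y.
Proof. by elim=> // Z i j l b _ IH ij /IH; apply: free_move. Qed.

Lemma nequiv_sym X Y : nequiv X Y -> nequiv Y X.
Proof.
elim=> [|Z i j l b _ IH ij]; first exact: nequiv_refl.
by have := nequiv1 (move Z i j l b) l (~~ b) ij; rewrite moveK // => /nequiv_trans; apply.
Qed.

Definition trivial_or_pm (g a : G) := a = 1 \/ exists b, a = sgn b g.

Lemma nequiv_upd Y i k a c : i != k -> trivial_or_pm (Y i) a -> trivial_or_pm (Y i) c ->
  nequiv Y (upd Y k (a * Y k * c)).
Proof.
move=> ik ha hc; rewrite eq_sym in ik.
have h1 : nequiv Y (upd Y k (a * Y k)).
  case: ha => [->|[b ->]]; last by exact: (nequiv1 Y true b ik).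
  have -> : upd Y k (1 * Y k) = Y; last exact: nequiv_refl.
  by apply/funext => m; rewrite /upd; case: eqP => // ->; rewrite mul1g.
apply: nequiv_trans h1 _; set Z := upd Y k _.
have Zi : Z i = Y i by rewrite /Z upd_neq // eq_sym.
have -> : upd Y k (a * Y k * c) = upd Z k (Z k * c).
  by apply/funext => m; rewrite /Z /upd eqxx; case: eqP.
case: hc => [->|[b ->]]; last by rewrite -Zi; exact: (nequiv1 Z false b ik).
have -> : upd Z k (Z k * 1) = Z; last exact: nequiv_refl.
by apply/funext => m; rewrite /upd; case: eqP => // ->; rewrite mulg1.
Qed.

(** Whitehead moves.  The multiplier itself stays unchanged, so the other entries can be
    treated one after the other. *)
Lemma nequiv_whitehead i Y Y' : Y' i = Y i ->
  (forall k, k != i -> exists a c,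
     [/\ trivial_or_pm (Y i) a, trivial_or_pm (Y i) c & Y' k = a * Y k * c]) ->
  nequiv Y Y'.
Proof.
move=> Yi hY.
suff h (s : seq I) : nequiv Y (fun k => if k \in s then Y' k else Y k).
  by have := h (enum I); congr nequiv; apply/funext => k; rewrite mem_enum.
elim: s => [|k s IH]; first exact: nequiv_refl.
have [ks|ks] := boolP ((k \in s) || (k == i)).
  move: IH; congr nequiv; apply/funext => m; rewrite inE.
  case: eqP => //= ->; case/orP: ks => [->//|/eqP ->]; first by rewrite Yi if_same.
move: ks; rewrite negb_or => /andP[ks ki].
have [a [c [ha hc E]]] := hY k ki.
apply: nequiv_trans IH _; set Z := fun m => if m \in s then _ else _.
have Zi : Z i = Y i by rewrite /Z Yi if_same.
have Zk : Z k = Y k by rewrite /Z (negPf ks).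
have -> : (fun m => if m \in k :: s then Y' m else Y m) = upd Z k (a * Z k * c).
  by apply/funext => m; rewrite /upd inE; case: eqP => //= ->; rewrite Zk.
by apply: (nequiv_upd (i := i)); rewrite ?Zi // eq_sym.
Qed.

(** [(a, b) |-> (a, a b) |-> (b^-1, a b) |-> (b^-1, a)]. *)
Lemma nequiv_swap Y i j : i != j -> nequiv Y (upd (upd Y j (Y i)) i (Y j)^-1).
Proof.
move=> ij; have ji : j != i by rewrite eq_sym.
apply: (nequiv_trans (nequiv1 Y true false ji)); set Y1 := move _ _ _ _ _.
apply: (nequiv_trans (nequiv1 Y1 true true ij)); set Y2 := move _ _ _ _ _.
have := nequiv1 Y2 false false ji; congr nequiv; apply/funext => m.
rewrite /Y2 /move /Y1 /move /upd eqxx (negPf ij) (negPf ji) eqxx /=.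
have [->|mj] := eqVneq m j; first by rewrite (negPf ji) mulVKg.
by case: eqP => // _; rewrite invgM mulgVK.
Qed.

End NielsenEquivalence.

(** * Nielsen's theorem by folding *)

(** By induction on the pairs to be respected: composing with a transposition corrects one
    value and keeps the previous ones. *)
Lemma perm_extend (T : finType) (r : T -> T -> Prop) :
  (forall s t t', r s t -> r s t' -> t = t') ->
  (forall s s' t, r s t -> r s' t -> s = s') ->
  exists pi : {perm T}, forall s t, r s t -> pi s = t.
Proof.
move=> rf ri.
suff h (ps : seq (T * T)) : exists pi : {perm T},
    forall q, q \in ps -> r q.1 q.2 -> pi q.1 = q.2.
  have [pi piP] := h (enum {: T * T}); exists pi => s t.
  by apply: (piP (s, t)); rewrite mem_enum.
elim: ps => [|[s t] ps [pi IH]]; first by exists 1.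
have [rst|nrst] := pselect (r s t); last first.
  by exists pi => q; rewrite inE => /orP[/eqP-> /nrst|/IH].
exists (pi * tperm (pi s) t) => -[s' t'] /= qin rst'; rewrite permM.
have [ss|ss] := eqVneq s' s.
  by rewrite ss tpermL; apply: rf rst _; rewrite -ss.
move: qin; rewrite inE xpair_eqE (negPf ss) /= => /IH /(_ rst') /= E.
rewrite -E tpermD ?(inj_eq perm_inj) 1?eq_sym // E.
by apply: contra_neq ss => tt; apply: ri rst' _; rewrite tt.
Qed.

Section Folding.
Variables (I : finType) (G : groupType) (X : I -> G).
Implicit Types (Y : I -> G) (u v w : word I) (U : seq (word I)) (l : letter I).

(** [U] is the vertex set of a finite tree rooted at [[::]], an edge joining a
    word to its one-letter extensions.  An element is represented on [U] when it
    labels a loop at the root that leaves the tree along a single edge. *)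
Definition represented U (g : G) := exists u l v,
  [/\ u \in U, v \in U & g = ev X u * sgn l.2 (X l.1) * (ev X v)^-1].

Definition tree U := [/\ uniq U, [::] \in U & forall u l, rcons u l \in U -> u \in U].

Lemma representedV U g : represented U g -> represented U g^-1.
Proof.
move=> [u [l [v [uU vU ->]]]]; exists v, (flip l), u; split=> //.
by rewrite !invgM invgK sgnV mulgA.
Qed.

Definition regraft v w (k : word I) := if prefix w k then v ++ drop (size w) k else k.

Lemma prefix_drop (w k : word I) : prefix w k -> k = w ++ drop (size w) k.
Proof. by case/prefixP => s ->; rewrite drop_size_cat. Qed.

Lemma ev_regraft v w g k : ev X v = g * ev X w ->
  ev X (regraft v w k) = if prefix w k then g * ev X k else ev X k.
Proof.
move=> E; rewrite /regraft; case: ifP => // /prefix_drop wk.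
by rewrite {2}wk !ev_cat E mulgA.
Qed.

Lemma tree_regraft U v w : tree U -> v \in U -> w \in U -> v != w -> ~~ prefix w v ->
  tree (undup (map (regraft v w) U)) /\ (size (undup (map (regraft v w) U)) < size U)%N.
Proof.
move=> [uU nU cU] vU wU vw nwv; set th := regraft v w.
have thv : th v = v by rewrite /th /regraft (negPf nwv).
have thw : th w = v by rewrite /th /regraft prefix_refl drop_size cats0.
have npre u l : prefix w u -> prefix w (rcons u l).
  by move=> h; apply: prefix_trans h _; apply: prefix_rcons.
split; last first.
  have -> : size U = (size (map th (rem w U))).+1.
    by rewrite size_map size_rem // prednK //; case: (U) wU.
  rewrite ltnS; apply: uniq_leq_size; first exact: undup_uniq.
  move=> y; rewrite mem_undup => /mapP[k kU ->].
  have [->|kw] := eqVneq k w; last by apply: map_f; rewrite mem_rem_uniq // inE kw.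
  by rewrite thw -thv; apply: map_f; rewrite mem_rem_uniq // inE vw.
split; first exact: undup_uniq.
  rewrite mem_undup; apply/mapP; exists [::] => //.
  rewrite /th /regraft; case: ifP => //; rewrite prefixs0 => /eqP w0.
  by move: nwv; rewrite w0 prefix0s.
move=> u l; rewrite !mem_undup => /mapP[k kU].
have keep x : x \in U -> ~~ prefix w x -> x \in map th U.
  by move=> xU nx; apply/mapP; exists x; rewrite // /th /regraft (negPf nx).
rewrite {1}/th /regraft; case: ifP => [/prefixP[s kE]|nwk E].
  move: kU; rewrite {k}kE drop_size_cat //; case/lastP: s => [|s x] kU.
    rewrite cats0 => E; rewrite -E in vU; apply: keep (cU _ _ vU) _.
    by apply: contra nwv => /npre; rewrite -E; apply.
  rewrite -rcons_cat => /rcons_inj[-> _]; apply/mapP; exists (w ++ s).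
    by apply: (cU _ x); rewrite rcons_cat.
  by rewrite /th /regraft prefix_prefix drop_size_cat.
rewrite -{k}E in kU nwk.
apply: keep; first exact: cU kU.
by apply: contraFN nwk => /npre; apply.
Qed.

(** Identifying two vertices [v] and [w] whose labels differ by the factor [g].
    The branch at [w] is carried to [v] by a Whitehead move, and the edge that
    used to attach [w] to the tree now represents [g^-1]. *)
Lemma fold_vertices U Y v w g : tree U -> v \in U -> w \in U -> v != w ->
  ev X v = g * ev X w ->
  (g = 1 /\ forall i, represented U (Y i)) \/
  (exists i b, g = sgn b (Y i) /\ forall k, k != i -> represented U (Y k)) ->
  exists U' Y', [/\ tree U', (size U' < size U)%N, nequiv Y Y' &
    forall i, represented U' (Y' i)].
Proof.
wlog nwv : v w g / ~~ prefix w v.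
  move=> W tU vU wU vw E h.
  have [pwv|npwv] := boolP (prefix w v); last exact: W E h.
  apply: (W w v g^-1) => //; first 1 last.
  - by rewrite eq_sym.
  - by rewrite E mulKg.
  - case: h => [[g1 h]|[i [b [gE h]]]]; first by left; rewrite g1 invg1.
    by right; exists i, (~~ b); rewrite sgnV gE.
  apply: contra vw => /prefix_drop wE; move/prefix_drop: pwv => vE.
  have s0 : size (drop (size v) w) = 0%N.
    by move: (congr1 size wE) (congr1 size vE); rewrite !size_cat; lia.
  by rewrite wE (size0nil s0) cats0.
move=> tU vU wU vw E h; have [tU' sU'] := tree_regraft tU vU wU vw nwv.
set U' := undup _ in tU' sU'.
have inU' k : k \in U -> regraft v w k \in U' by move=> kU; rewrite mem_undup map_f.
case: h => [[g1 h]|[i [b [gE h]]]].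
  exists U', Y; split=> //; first exact: nequiv_refl.
  move=> i; have [u [l [u' [uU u'U ->]]]] := h i.
  exists (regraft v w u), l, (regraft v w u'); split; try exact: inU'.
  by rewrite !(ev_regraft _ E) g1 !mul1g !if_same.
have /choice[Y' Y'P] : forall k, exists y, (k == i -> y = Y i) /\
   (k != i -> represented U' y /\ exists a c,
     [/\ trivial_or_pm (Y i) a, trivial_or_pm (Y i) c & y = a * Y k * c]).
  move=> k; have [->|ki] := eqVneq k i; first by exists (Y i).
  have [u [l [u' [uU u'U YE]]]] := h k ki.
  exists (ev X (regraft v w u) * sgn l.2 (X l.1) * (ev X (regraft v w u'))^-1).
  split=> // _; split.
    by exists (regraft v w u), l, (regraft v w u'); split; try exact: inU'.
  exists (if prefix w u then g else 1), (if prefix w u' then g^-1 else 1); split.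
  - by case: ifP; [right; exists b|left].
  - by case: ifP; [right; exists (~~ b); rewrite sgnV gE|left].
  rewrite !(ev_regraft _ E) YE; case: ifP => _; case: ifP => _;
    by rewrite ?invgM ?mul1g ?mulg1 ?mulgA.
exists U', Y'; split=> //.
  apply: (nequiv_whitehead (i := i)); first by case: (Y'P i) => ->.
  by move=> k ki; case: (Y'P k) => _ /(_ ki)[].
move=> k; have [->|ki] := eqVneq k i; last by case: (Y'P k) => _ /(_ ki)[].
have -> : Y' i = sgn b g by case: (Y'P i) => -> // _; rewrite gE sgnK.
suff rg : represented U' g^-1.
  by case: b {gE} => //=; rewrite -[g]invgK; apply: representedV.
case/lastP: w => [|w' l] in nwv wU vw E U' tU' sU' inU' {Y'P} *.
  by rewrite prefix0s in nwv.
have w'U : w' \in U by case: tU => _ _; apply; exact: wU.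
exists w', l, v; split.
- rewrite -[w'](_ : regraft v (rcons w' l) w' = _); first exact: inU'.
  rewrite /regraft; case: ifP => // /prefix_drop /(congr1 size).
  by rewrite size_cat size_rcons; lia.
- rewrite -[v](_ : regraft v (rcons w' l) v = _); first exact: inU'.
  by rewrite /regraft (negPf nwv).
- by rewrite -ev_rcons E invgM mulVKg.
Qed.

Section Immersion.
Variables (U : seq (word I)) (Y : I -> G) (a b : I -> word I) (l : I -> letter I).

(** The edges of the graph made of the tree [U] and of one further edge for each
    entry of [Y]. *)
Definition adjacent u x v :=
  [\/ v = rcons u x, u = rcons v (flip x),
      exists i, [/\ a i = u, l i = x & b i = v] |
      exists i, [/\ a i = v, l i = flip x & b i = u]].

Lemma adjacent_sym u x v : adjacent u x v -> adjacent v (flip x) u.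
Proof.
case=> [->|->|[i [ai li bi]]|[i [ai li bi]]].
- by apply: Or42; rewrite flipK.
- exact: Or41.
- by apply: Or44; exists i; rewrite flipK.
- by apply: Or43; exists i.
Qed.

Hypothesis tU : tree U.
Hypotheses (aU : forall i, a i \in U) (bU : forall i, b i \in U).
Hypothesis YE : forall i, Y i = ev X (a i) * sgn (l i).2 (X (l i).1) * (ev X (b i))^-1.
Hypotheses (fX : is_free X) (hYX : hull Y = hull X).

(** Without folds each variable acts on the vertices as a partial injection;
    extend these to permutations.  Every [Y i] fixes the root, hence so does the
    whole group, whereas the element labelled by a vertex moves the root there. *)
Lemma immersion_trivial :
  (forall u x v v', u \in U -> v \in U -> v' \in U ->
     adjacent u x v -> adjacent u x v' -> v = v') ->
  forall u, u \in U -> u = [::].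
Proof.
move=> inj; have [_ nU cU] := tU.
pose T := seq_sub U.
have /choice[pi piP] : forall i, exists pi : {perm T}, forall s t : T,
    adjacent (val s) (i, false) (val t) -> pi s = t.
  move=> i; apply: perm_extend => [s t t' h h'|s s' t h h']; apply: val_inj.
    by apply: inj h h'; apply: valP.
  by apply: inj (adjacent_sym h) (adjacent_sym h'); apply: valP.
pose root : T := SeqSub nU.
have letterP x (s t : T) : adjacent (val s) x (val t) -> sgn x.2 (pi x.1) s = t.
  case: x => i [] /= h; last exact: piP.
  by rewrite -(piP i t s) ?permK //; apply: (adjacent_sym h).
have pathP u (uU : u \in U) : ev pi u root = SeqSub uU.
  elim/last_ind: u uU => [|u x IH] uU; first by rewrite perm1; apply: val_inj.
  rewrite ev_rcons permM (IH (cU _ _ uU)).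
  by apply: letterP; apply: Or41.
pose yw i := a i ++ l i :: winv (b i).
have YW i : Y i = ev X (yw i) by rewrite /yw ev_cat ev_cons ev_winv YE mulgA.
have ywP i : ev pi (yw i) root = root.
  rewrite /yw ev_cat ev_cons ev_winv !permM (pathP _ (aU i)).
  rewrite (letterP _ _ (SeqSub (bU i))); last by apply: Or43; exists i.
  by rewrite -(pathP _ (bU i)) permK.
have sR : is_subgroup [set g : {perm T} | g root = root].
  apply/is_subgroupP; split=> /= [|g h gR hR]; first by rewrite perm1.
  by rewrite permM gR -{1}hR permK.
move=> u uU; have : hull Y (ev X u) by rewrite hYX; apply: hull_ev.
case=> w _; rewrite (eq_ev YW) -ev_subst => /(free_eq fX pi) E.
have : ev pi u root = root by rewrite -E ev_subst; exact: (ev_sub w sR ywP).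
by rewrite pathP => /(congr1 val).
Qed.

End Immersion.

(** A smallest tree on which some Nielsen transform of [Y] is represented admits
    no fold, hence is reduced to its root. *)
Theorem nielsen Y : is_free X -> hull Y = hull X ->
  exists2 Y', nequiv Y Y' & forall i, exists l, Y' i = sgn l.2 (X l.1).
Proof.
move=> fX hYX.
suff main n U Z : (size U <= n)%N -> tree U -> nequiv Y Z ->
    (forall i, represented U (Z i)) ->
    exists2 Y', nequiv Y Y' & forall i, exists l, Y' i = sgn l.2 (X l.1).
  have /choice[c cP] : forall i, exists lw : letter I * word I, Y i = ev X (lw.1 :: lw.2).
    move=> i; have : hull X (Y i) by rewrite -hYX; apply: hull_gen.
    case=> -[|l w] _ <-; last by exists (l, w).
    by exists ((i, false), [:: (i, true)]); rewrite /= mulg1 mulgV.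
  pose prefixes (w : word I) := [seq take k w | k <- iota 0 (size w).+1].
  have prefixesP (u w : word I) : reflect (exists s, w = u ++ s) (u \in prefixes w).
    apply: (iffP mapP) => [[k _ ->]|[s ->]].
      by exists (drop k w); rewrite cat_take_drop.
    by exists (size u); rewrite ?take_size_cat // mem_iota size_cat; lia.
  pose U := undup ([::] :: flatten [seq prefixes (winv (c i).2) | i <- enum I]).
  have inU i u : u \in prefixes (winv (c i).2) -> u \in U.
    rewrite mem_undup in_cons => h; apply/orP; right.
    by apply/flatten_mapP; have iI := mem_enum I i; exists i.
  apply: (main (size U) U Y (leqnn _) _ (nequiv_refl _)); last first.
  - move=> i; exists [::], (c i).1, (winv (c i).2); split.
    + by rewrite mem_undup mem_head.
    + by apply: (inU i); apply/prefixesP; exists [::]; rewrite cats0.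
    + by rewrite ev_winv invgK mul1g cP.
  split; [exact: undup_uniq|by rewrite mem_undup mem_head|].
  move=> u l; rewrite {1}mem_undup in_cons; case: eqP => [|_ /=]; first by case: u.
  case/flatten_mapP => i _ /prefixesP[s E].
  by apply: (inU i); apply/prefixesP; exists (l :: s); rewrite -cat_rcons.
elim: n U Z => [|n IH] U Z; first by case: U => // _ [].
move=> sU tU YZ rZ.
have /choice[r rP] : forall i, exists r : word I * letter I * word I,
    [/\ r.1.1 \in U, r.2 \in U &
        Z i = ev X r.1.1 * sgn r.1.2.2 (X r.1.2.1) * (ev X r.2)^-1].
  by move=> i; have [u [l [v h]]] := rZ i; exists (u, l, v).
pose a i := (r i).1.1; pose l i := (r i).1.2; pose b i := (r i).2.
have aU i : a i \in U by case: (rP i).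
have bU i : b i \in U by case: (rP i).
have ZE i : Z i = ev X (a i) * sgn (l i).2 (X (l i).1) * (ev X (b i))^-1.
  by case: (rP i).
have hZX : hull Z = hull X by rewrite (nequiv_hull YZ).
pose adj := adjacent a b l.
have [inj|] := pselect (forall u x v v', u \in U -> v \in U -> v' \in U ->
    adj u x v -> adj u x v' -> v = v').
  have U0 := immersion_trivial tU aU bU ZE fX hZX inj.
  exists Z => // i; exists (l i).
  by rewrite ZE (U0 _ (aU i)) (U0 _ (bU i)) /= invg1 mul1g mulg1.
move=> /existsNP[u /existsNP[x /existsNP[v /existsNP[v']]]].
move=> /not_implyP[uU /not_implyP[vU /not_implyP[v'U]]].
move=> /not_implyP[uv /not_implyP[uv' /eqP vv']].
have fold g Z' : nequiv Z Z' -> ev X v = g * ev X v' ->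
    (g = 1 /\ forall i, represented U (Z' i)) \/
    (exists i b, g = sgn b (Z' i) /\ forall k, k != i -> represented U (Z' k)) ->
    exists2 Y', nequiv Y Y' & forall i, exists l, Y' i = sgn l.2 (X l.1).
  move=> ZZ' E h; have [U' [Y' [tU' sU' ZY' rY']]] := fold_vertices tU vU v'U vv' E h.
  apply: (IH U' Y') => //; first by rewrite -ltnS (leq_trans sU').
  exact: nequiv_trans YZ (nequiv_trans ZZ' ZY').
have rep i k : k != i -> represented U (Z k) by [].
have edge t : adj u x t -> ev X u * sgn x.2 (X x.1) = ev X t \/
    exists i c, ev X u * sgn x.2 (X x.1) = sgn c (Z i) * ev X t /\
      (c = false -> [/\ a i = u, l i = x & b i = t]) /\
      (c = true -> [/\ a i = t, l i = flip x & b i = u]).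
  case=> [->|E|[i [au lx bt]]|[i [au lx bt]]].
  - by left; rewrite ev_rcons.
  - by left; rewrite {1}E ev_rcons sgnV mulgVK.
  - by right; exists i, false; rewrite /= ZE au lx bt mulgVK.
  - right; exists i, true; split=> //=.
    by rewrite ZE au lx bt /= sgnV !invgM !invgK mulgA mulgVK.
case: (edge _ uv) (edge _ uv') => [E|[i [c [E [Ef Et]]]]] [E'|[j [c' [E' [Ef' Et']]]]].
- apply: (fold 1 Z); [exact: nequiv_refl|by rewrite mul1g -E|by left].
- apply: (fold (sgn c' (Z j)) Z); [exact: nequiv_refl|by rewrite -E|right].
  by exists j, c'; split=> // k; apply: rep.
- apply: (fold (sgn (~~ c) (Z i)) Z); first exact: nequiv_refl.
    by rewrite -E' E sgnV mulKg.
  by right; exists i, (~~ c); split=> // k; apply: rep.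
have [ij|ji] := eqVneq i j.
  case/eqP: vv'; rewrite ij in E Ef Et.
  case: c {E} Ef Et => [_ /(_ erefl)[ai li bi]|/(_ erefl)[ai li bi] _];
    case: c' {E'} Ef' Et' => [_ /(_ erefl)[aj lj bj]|/(_ erefl)[aj lj bj] _].
  - by rewrite -ai -aj.
  - by move: lj; rewrite li => /(congr1 snd) /=; case: (x.2).
  - by move: lj; rewrite li => /(congr1 snd) /=; case: (x.2).
  - by rewrite -bi -bj.
(* multiplying the entry [j] by the entry [i] turns it into the factor between
   the two end points *)
have ji' : j != i by rewrite eq_sym.
pose Z' := move Z j i (~~ c') (c (+) ~~ c').
apply: (fold (sgn c' (Z' j)) Z'); first exact: nequiv1.
  have -> : ev X v = sgn (~~ c) (Z i) * (sgn c' (Z j) * ev X v').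
    by rewrite -E' E sgnV mulKg.
  rewrite mulgA /Z' /move updE; congr (_ * _).
  by case: c c' {E Ef Et E' Ef' Et' Z'} => [] [] /=; rewrite ?invgM ?invgK.
right; exists j, c'; split=> // k kj; rewrite /Z' /move upd_neq //.
Qed.

End Folding.

(** * Signed permutations of a family *)

Section SignedPermutations.
Variables (I : finType) (G : groupType) (X : I -> G).
Implicit Types (W : I -> G) (s : {perm I}) (e : I -> bool).

Definition sperm s e : I -> G := fun a => sgn (e a) (X (s a)).

Definition swap_sign e i j a := if a == i then ~~ e j else if a == j then e i else e a.

Lemma nequiv_sperm s e i j : i != j ->
  nequiv (sperm s e) (sperm (tperm i j * s) (swap_sign e i j)).
Proof.
move=> ij; have := nequiv_swap (sperm s e) ij; congr nequiv; apply/funext => a.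
rewrite /upd /sperm /swap_sign permM.
have [->|ai] := eqVneq a i; first by rewrite tpermL sgnV.
have [->|aj] := eqVneq a j; first by rewrite tpermR.
by rewrite tpermD // eq_sym.
Qed.

Lemma nequiv_flip s e i j : i != j ->
  nequiv (sperm s e) (sperm s (fun a => (e a) (+) (a == i) (+) (a == j))).
Proof.
move=> ij; apply: nequiv_trans (nequiv_sperm s e ij) _.
apply: nequiv_trans (nequiv_sperm _ _ ij) _.
rewrite mulgA tperm2 mul1g; set e1 := swap_sign _ _ _; set e2 := fun a => _.
rewrite (_ : e1 = e2); first exact: nequiv_refl.
apply/funext => a; rewrite /e1 /e2 /swap_sign eqxx (eq_sym j) (negPf ij) eqxx.
have [->|ai] := eqVneq a i; first by rewrite (negPf ij) addbT addbF.
by have [->|aj] := eqVneq a j; rewrite ?addbT !addbF.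
Qed.

Lemma sperm1 : sperm 1 (fun=> false) = X.
Proof. by apply/funext => a; rewrite /sperm perm1. Qed.

(** A third index absorbs the signs. *)
Lemma nequiv_place i k l i' k' b c :
  i != k -> l != i -> l != k -> i' != k' ->
  exists s e, [/\ nequiv X (sperm s e), s i = i', s k = k', e i = b & e k = c].
Proof.
move=> ik li lk ik'.
have [s1 [e1 [n1 s1i]]] : exists s e, nequiv X (sperm s e) /\ s i = i'.
  have [<-|ii'] := eqVneq i i'.
    by exists 1, (fun=> false); rewrite sperm1 perm1; split=> //; apply: nequiv_refl.
  exists (tperm i i'), (swap_sign (fun=> false) i i'); rewrite tpermL; split=> //.
  by have := nequiv_sperm 1 (fun=> false) ii'; rewrite mulg1 sperm1.
have [s2 [e2 [n2 s2i s2k]]] : exists s e, [/\ nequiv X (sperm s e), s i = i' & s k = k'].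
  have [E|nE] := eqVneq (s1^-1 k') k.
    by exists s1, e1; split=> //; rewrite -E permKV.
  exists (tperm k (s1^-1 k') * s1), (swap_sign e1 k (s1^-1 k')); split.
  - by apply: nequiv_trans n1 _; apply: nequiv_sperm; rewrite eq_sym.
  - rewrite permM tpermD ?s1i // 1?eq_sym //.
    by apply: contra_neq ik' => E; rewrite -s1i {1}E permKV.
  - by rewrite permM tpermL permKV.
have [e3 [n3 e3i]] : exists e, nequiv X (sperm s2 e) /\ e i = b.
  have [<-|eb] := eqVneq (e2 i) b; first by exists e2.
  eexists; split; first exact: nequiv_trans n2 (nequiv_flip s2 e2 li).
  by rewrite /= eqxx eq_sym (negPf li) addbF addbT; case: (e2 i) b eb => [] [].
have [e4 [n4 e4i e4k]] : exists e, [/\ nequiv X (sperm s2 e), e i = b & e k = c].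
  have [<-|eb] := eqVneq (e3 k) c; first by exists e3.
  eexists; split; first exact: nequiv_trans n3 (nequiv_flip s2 e3 lk).
    by rewrite /= eq_sym (negPf li) (negPf ik) !addbF.
  by rewrite /= eqxx eq_sym (negPf lk) addbF addbT; case: (e3 k) c eb => [] [].
by exists s2, e4.
Qed.

(** Signs can be changed two at a time, so that sorting leaves at most one. *)
Lemma nequiv_sort s e : exists o : option I,
  nequiv (sperm s e) (fun a => sgn (o == Some a) (X a)).
Proof.
suff [e' h] : exists e', nequiv (sperm s e) (sperm 1 e').
  have [m] := ubnP #|[pred a | e' a]|; elim: m e' h => // m IH e' h em.
  have [/existsP[i /existsP[j /and3P[ij ei ej]]]|] :=
      boolP [exists i, exists j, [&& i != j, e' i & e' j]].
    apply: (IH _ (nequiv_trans h (nequiv_flip 1 e' ij))).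
    rewrite -ltnS; apply: leq_trans em; rewrite ltnS; apply: proper_card.
    apply/fintype.properP; split; last by exists i; rewrite !inE ?eqxx ?ei // (negPf ij).
    apply/fintype.subsetP => a; rewrite !inE.
    have [->|_] := eqVneq a i; first by rewrite ei.
    by have [->|_] := eqVneq a j; rewrite ?ej // !addbF.
  rewrite negb_exists => /forallP hu.
  exists [pick a | e' a]; move: h; congr nequiv; apply/funext => a.
  rewrite /sperm perm1; congr sgn; case: pickP => [i ei|ne]; last by rewrite ne.
  rewrite (inj_eq Some_inj); have [<-|ia] := eqVneq i a; first by rewrite ei.
  apply/negbTE; move: (hu i); rewrite negb_exists => /forallP/(_ a).
  by rewrite ia ei.
have [m] := ubnP #|[pred a | s a != a]|; elim: m s e => // m IH s e sm.
have [/existsP[a sa]|] := boolP [exists a, s a != a]; last first.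
  rewrite negb_exists => /forallP s1; exists e.
  rewrite (_ : s = 1); first exact: nequiv_refl.
  by apply/permP => a; rewrite perm1; apply/eqP; rewrite -[_ == _]negbK.
have ac : a != s^-1 a by apply: contra_neq sa => {1}->; rewrite permKV.
have [|e' h] := IH (tperm a (s^-1 a) * s) (swap_sign e a (s^-1 a)).
  rewrite -ltnS; apply: leq_trans sm; rewrite ltnS; apply: proper_card.
  apply/fintype.properP; split; last by exists a; rewrite !inE // permM tpermL permKV eqxx.
  apply/fintype.subsetP => b; rewrite !inE permM.
  have [->|ba] := eqVneq b a; first by rewrite tpermL permKV eqxx.
  have [->|bc] := eqVneq b (s^-1 a); first by rewrite permKV tpermR ac.
  by rewrite tpermD // eq_sym.
by exists e'; apply: nequiv_trans h; apply: nequiv_sperm.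
Qed.

End SignedPermutations.

(** * Abelianization and determinants *)

(** Additive groups as targets of [ehom]. *)
Definition addgrp (V : zmodType) : Type := V.
HB.instance Definition _ (V : zmodType) := Choice.on (addgrp V).
HB.instance Definition _ (V : zmodType) := isGroup.Build (addgrp V)
  (@GRing.addrA V) (@GRing.add0r V) (@GRing.addr0 V) (@GRing.addNr V) (@GRing.addrN V).

Lemma ev_addgrp (I : Type) (V : zmodType) (f : I -> addgrp V) w :
  ev f w = (\sum_(l <- w) (if l.2 then - (f l.1 : V) else f l.1))%R.
Proof. by elim: w => [|[i b] w IH]; rewrite ?big_nil ?big_cons //= IH; case: b. Qed.

Section Exponents.
Variables (I : finType) (G : groupType) (X : I -> G).
Hypothesis fX : is_free X.
Local Notation n := #|I|.
Local Notation H := (hull X).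

(** The vector of the exponent sums of an element. *)
Definition exps (g : G) : 'rV[int]_n :=
  ehom X (fun i => delta_mx 0%R (enum_rank i) : addgrp 'rV[int]_n) g.

Lemma expsM x y : H x -> H y -> exps (x * y) = (exps x + exps y)%R.
Proof. by move=> Hx Hy; rewrite /exps ehomM. Qed.

Lemma exps_ev w : exps (ev X w) =
  (\sum_(l <- w) (if l.2 then - delta_mx 0 (enum_rank l.1) else delta_mx 0 (enum_rank l.1)))%R.
Proof. by rewrite /exps ehomE // ev_addgrp. Qed.

Lemma exps_gen i : exps (X i) = delta_mx 0%R (enum_rank i).
Proof. by rewrite /exps ehom_gen. Qed.

Lemma exps_count w i : exps (ev X w) 0%R (enum_rank i) =
  ((count_mem (i, false) w)%:Z - (count_mem (i, true) w)%:Z)%R.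
Proof.
rewrite exps_ev; elim: w => [|[k b] w IH]; first by rewrite big_nil mxE.
rewrite big_cons mxE IH /= !xpair_eqE.
by case: b; rewrite !mxE (inj_eq enum_rank_inj) [i == k]eq_sym; case: (k == i) => /=; lia.
Qed.

(** Additive maps on the hull are linear in the exponents. *)
Lemma exps_linear m (f : G -> 'rV[int]_m) :
  (forall x y, H x -> H y -> f (x * y) = (f x + f y)%R) ->
  forall x, H x -> f x = (exps x *m \matrix_(a < n) f (X (enum_val a)))%R.
Proof.
move=> fM _ [w _ <-]; rewrite exps_ev.
rewrite (@morph_ev _ _ (addgrp 'rV[int]_m) _ f X w (hull_sub X) fM (hull_gen X)).
rewrite ev_addgrp mulmx_suml; apply: eq_bigr => -[i b] _ /=.
by case: b; rewrite ?mulNmx -rowE rowK enum_rankK.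
Qed.

Lemma exps_onto v : exists2 x, H x & exps x = v.
Proof.
pose P (v : 'rV[int]_n) := exists2 x, H x & exps x = v.
have sH := hull_sub X.
have PD u w : P u -> P w -> P (u + w)%R.
  move=> [x Hx <-] [y Hy <-]; exists (x * y); last exact: expsM.
  exact: is_subgroupM.
have P0 : P 0%R by exists 1; [exact: is_subgroup1|rewrite (exps_ev [::]) big_nil].
have PN u : P u -> P (- u)%R.
  move=> [x Hx <-]; have HV := is_subgroupV sH Hx; exists x^-1 => //.
  apply/eqP; rewrite -GRing.addr_eq0 -expsM // mulVg (exps_ev [::]) big_nil //.
have Pn u k : P u -> P (u *+ k)%R.
  by move=> Pu; elim: k => [|k IH]; rewrite ?GRing.mulr0n // GRing.mulrS; apply: PD.
rewrite -/(P v) (row_sum_delta v); elim/big_ind: _ => // a _.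
have Pa : P (delta_mx 0 a)%R.
  by exists (X (enum_val a)); [exact: hull_gen|rewrite exps_gen enum_valK].
have scale (z : int) (u : 'rV[int]_n) : (z *: u = u *~ z)%R by rewrite -[z in LHS]intz scaler_int.
case: (v 0%R a) => k; rewrite scale; first exact: Pn.
by rewrite NegzE mulrNz; apply/PN/Pn.
Qed.

Lemma commutator_derived x y : H x -> H y -> derived_subgroup H [~ x, y].
Proof. by move=> Hx Hy M [sM]; apply; exists x => //; exists y. Qed.

Lemma derived_subgroup_sub : is_subgroup (derived_subgroup H).
Proof.
apply/is_subgroupP; split=> [M [sM _]|x y Dx Dy M hM]; first exact: is_subgroup1.
by apply: is_subgroupF; [case: hM|exact: Dx|exact: Dy].
Qed.

(** A letter of a word with zero exponent sums also occurs inverted; moving the two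
    occurrences next to each other costs a commutator. *)
Lemma exps_derived w : exps (ev X w) = 0%R -> derived_subgroup H (ev X w).
Proof.
have [m] := ubnP (size w); elim: m w => // m IH [|l w] /= sw E.
  exact: (is_subgroup1 derived_subgroup_sub).
have lw : flip l \in w.
  have := exps_count (l :: w) l.1; rewrite E mxE /= => /eqP.
  rewrite -has_pred1 has_count.
  by case: l {E} => i [] /=; rewrite /flip /= !xpair_eqE !eqxx /=; lia.
case/splitPr: lw sw E => w1 w2; rewrite size_cat /= => sw E.
set g := sgn l.2 (X l.1); have Hg : H g by apply: sgn_sub; [exact: hull_sub|exact: hull_gen].
have -> : g * ev X (w1 ++ flip l :: w2) = [~ g^-1, (ev X w1)^-1] * ev X (w1 ++ w2).
  rewrite !ev_cat /= sgnV -/g /commg /conjg !invgK !mulgA mulgVK //.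
apply: (is_subgroupM derived_subgroup_sub).
  by apply: commutator_derived; apply: (is_subgroupV (hull_sub X));
    [exact: Hg|exact: hull_ev].
apply: (IH (w1 ++ w2)); first by rewrite size_cat; lia.
move: E; rewrite -[sgn _ _ * _]/(ev X (l :: w1 ++ flip l :: w2)) !exps_ev.
rewrite big_cons !big_cat big_cons /= GRing.addrCA.
by case: (l.2) => /=; rewrite ?GRing.addKr ?GRing.addNKr.
Qed.

Lemma exps_abelianization : is_abelianization H exps.
Proof.
split; [exact: expsM|exact: exps_onto|].
move=> _ [w _ <-]; split; first exact: exps_derived.
have sK : is_subgroup [set x | H x /\ exps x = 0%R].
  have sH := hull_sub X; apply/is_subgroupP; split=> /=.
    by split; [exact: is_subgroup1|rewrite (exps_ev [::]) big_nil].
  move=> x y [Hx x0] [Hy y0]; have HV := is_subgroupV sH Hy.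
  split; first exact: is_subgroupF.
  by have := expsM (is_subgroupM sH Hx HV) Hy; rewrite mulgVK x0 y0 GRing.addr0.
move=> D; suff [] : [set x | H x /\ exps x = 0%R] (ev X w) by [].
apply: D; split=> //.
have sH := hull_sub X; move=> _ [x Hx [y Hy <-]].
have [HVx HVy] := (is_subgroupV sH Hx, is_subgroupV sH Hy).
have Hc : H (x * y) by exact: is_subgroupM.
have Hv : H [~ x, y] by rewrite /commg /conjg; do 3!apply: is_subgroupM => //.
split=> //=; have : exps (x * y) = exps (y * x * [~ x, y]) by rewrite -commgC.
rewrite (expsM (is_subgroupM sH Hy Hx) Hv) !(expsM Hx, expsM Hy) //.
by rewrite [(exps y + _)%R]GRing.addrC -[LHS]GRing.addr0 => /GRing.addrI.
Qed.

Definition exps_mx (Y : I -> G) : 'M[int]_n := \matrix_(a < n) exps (Y (enum_val a)).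

Lemma exps_mx1 : exps_mx X = 1%:M%R.
Proof. by apply/row_matrixP => a; rewrite rowK exps_gen enum_valK row1. Qed.

Lemma det_move Y i j l b : i != j -> (forall k, H (Y k)) ->
  (\det (exps_mx (move Y i j l b)) = \det (exps_mx Y))%R.
Proof.
move=> ij HY; set M := exps_mx Y; set M' := exps_mx _.
pose C := (\matrix_(a < n) (if a == enum_rank i then row (enum_rank j) M else row a M))%R.
have C0 : (\det C = 0)%R.
  apply: (determinant_alternate (i1 := enum_rank i) (i2 := enum_rank j)).
    by rewrite (inj_eq enum_rank_inj).
  by move=> c; rewrite !mxE eqxx (inj_eq enum_rank_inj) eq_sym (negPf ij) !mxE.
have rowM Z a : row a (exps_mx Z) = exps (Z (enum_val a)) by rewrite rowK.
have other a : row (lift (enum_rank i) a) M' = row (lift (enum_rank i) a) M.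
  rewrite !rowM /move upd_neq // -(inj_eq enum_rank_inj) enum_valK eq_sym.
  exact: neq_lift.
have HV := is_subgroupV (hull_sub X) (HY j).
have eV : exps (Y j)^-1 = (- exps (Y j))%R.
  apply/eqP; rewrite -GRing.addr_eq0 -expsM // mulVg.
  by rewrite (exps_ev [::]) big_nil.
rewrite (@determinant_multilinear _ _ M' M C (enum_rank i) 1%R (if b then -1 else 1)%R).
- by rewrite C0 GRing.mulr0 GRing.addr0 GRing.mul1r.
- rewrite [row _ C]rowK eqxx !rowM !enum_rankK /move updE GRing.scale1r.
  by case: l b {M' other} => [] []; rewrite /= expsM // ?eV ?GRing.scaleN1r ?GRing.scale1r //
    GRing.addrC.
- by apply/row_matrixP => a; rewrite !row_rowsub other.
- apply/row_matrixP => a; rewrite !row_rowsub [row _ C]rowK.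
  by rewrite eq_sym (negPf (neq_lift _ _)) other.
Qed.

Lemma exps_act (phi : G -> G) (Y : I -> G) :
  (forall x y, H x -> H y -> phi (x * y) = phi x * phi y) ->
  (forall i, phi (X i) = Y i) -> (forall i, H (Y i)) ->
  forall x, H x -> exps (phi x) = (exps x *m exps_mx Y)%R.
Proof.
move=> phiM phiX HY x Hx.
have phiH y : H y -> H (phi y).
  move=> [w _ <-]; rewrite (morph_ev w (hull_sub X) phiM (hull_gen X)).
  by apply: (ev_sub _ (hull_sub X)) => i; rewrite /= phiX.
rewrite (@exps_linear _ (fun x => exps (phi x))) //.
  by congr (_ *m _)%R; apply/row_matrixP => a; rewrite !rowK phiX.
by move=> u v Hu Hv; rewrite phiM // expsM //; apply: phiH.
Qed.

Lemma det1_acts_by_SL (phi : G -> G) (Y : I -> G) :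
  (forall x y, H x -> H y -> phi (x * y) = phi x * phi y) ->
  (forall i, phi (X i) = Y i) -> (forall i, H (Y i)) ->
  (\det (exps_mx Y) = 1)%R -> acts_by_SL H phi.
Proof.
move=> phiM phiX HY dY; exists n, exps, (exps_mx Y).
by split=> //; [exact: exps_abelianization|exact: exps_act].
Qed.

(** Any two abelianizations differ by an invertible matrix. *)
Lemma acts_by_SL_det1 (phi : G -> G) (Y : I -> G) :
  (forall x y, H x -> H y -> phi (x * y) = phi x * phi y) ->
  (forall i, phi (X i) = Y i) -> (forall i, H (Y i)) ->
  acts_by_SL H phi -> (\det (exps_mx Y) = 1)%R.
Proof.
move=> phiM phiX HY [r [ab [A [[abM abS abK] abA dA]]]].
pose P := (\matrix_(a < n) ab (X (enum_val a)))%R.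
have abP x : H x -> ab x = (exps x *m P)%R by apply: exps_linear.
have /choice[z zP] : forall j : 'I_r, exists z, H z /\ ab z = delta_mx 0%R j.
  by move=> j; have [z Hz Ez] := abS (delta_mx 0%R j); exists z.
pose Q := (\matrix_(j < r) exps (z j))%R.
have QP : (Q *m P = 1%:M)%R.
  apply/row_matrixP => j; have [Hz Ez] := zP j.
  by rewrite row_mul rowK -abP // Ez row1.
have Pinj (v : 'rV_n) : (v *m P = 0 -> v = 0)%R.
  have [x Hx <-] := exps_onto v; rewrite -abP // => /(abK _ Hx).
  by case: exps_abelianization => _ _ /(_ _ Hx)[].
have PQ : (P *m Q = 1%:M)%R.
  apply/eqP; rewrite -GRing.subr_eq0; apply/eqP/row_matrixP => a; rewrite row0.
  apply: Pinj; rewrite -row_mul mulmxBl -mulmxA QP mulmx1 mul1mx GRing.subrr row0 //.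
have rn : r = n.
  have := congr1 (fun M => \tr M)%R PQ; rewrite mxtrace_mulC QP !mxtrace1.
  by rewrite !natz => -[].
clear zP; subst r.
have Hphi x : H x -> H (phi x).
  move=> [w _ <-]; rewrite (morph_ev w (hull_sub X) phiM (hull_gen X)).
  by apply: (ev_sub _ (hull_sub X)) => i; rewrite /= phiX.
have MP : (exps_mx Y *m P = P *m A)%R.
  apply/row_matrixP => a; rewrite !row_mul !rowK -abP // -phiX abA //.
  exact: hull_gen.
have /(congr1 determinant) : (Q *m (exps_mx Y *m P) = A)%R by rewrite MP mulmxA QP mul1mx.
rewrite !det_mulmx GRing.mulrCA -det_mulmx QP det1 GRing.mulr1 dA //.
Qed.

End Exponents.

(** * Open subgroups and germs *)

(** The core in [F] of the intersection of [K] with an open normal subgroup of [F]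
    has finite index, and the quotient has [p]-power exponent, hence [p]-power order. *)
Lemma p_open_sub (p : nat) (F : groupType) (H K : set F) (T : finType) (c : F -> T) (q : nat) :
  p_open p H -> is_subgroup K -> K `<=` H ->
  (forall h k, H h -> K k -> K (k ^ h)) ->
  (forall h, H h -> K (h ^+ q)) -> p.-nat q ->
  (forall h h', H h -> H h' -> c h = c h' -> K (h^-1 * h')) ->
  p_open p K.
Proof.
move=> [sH [N [n [nN NH cN pn]]]] sK KH JK Kq pq cK.
have [sN JN] := nN; split=> //.
pose L := [set x | N x /\ forall y, K (x ^ y)].
have nL : is_normal L.
  split; last by move=> x y [Nx Kx]; split; [exact: JN|move=> z; rewrite -conjgM].
  apply/is_subgroupP; split.
    by split; [exact: is_subgroup1|move=> y; rewrite conj1g; exact: is_subgroup1].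
  move=> x y [Nx Kx] [Ny Ky]; split; first exact: is_subgroupF.
  by move=> z; rewrite conjMg conjVg; apply: is_subgroupF.
have [idx [t [tK idxP]]] := left_coset_reps sN cN.
have Nt x : N ((t (idx x))^-1 * x) by apply/idxP; rewrite tK.
have fin : finite_set (left_cosets L).
  pose Phi x := (idx x, [ffun i => c (((t (idx x))^-1 * x) ^ t i)]).
  have PhiP x y : Phi x = Phi y -> L (x^-1 * y).
    move=> [Exy /ffunP E]; move: (Nt x) (Nt y) E; rewrite -Exy.
    set u := _ * x; set v := _ * y => Nu Nv E.
    have -> : x^-1 * y = u^-1 * v by rewrite /u /v invgM invgK mulgA mulgK.
    clearbody u v => {Exy}; have NuV := is_subgroupV sN Nu.
    split=> [|z]; first exact: is_subgroupM.
    have -> : z = t (idx z) * ((t (idx z))^-1 * z) by rewrite mulVKg.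
    rewrite conjgM; apply: JK; first exact: NH.
    by rewrite conjMg conjVg; apply: cK; [apply/NH/JN..|have := E (idx z); rewrite !ffunE].
  pose psi (d : 'I_n * {ffun 'I_n -> T}) := [set xget 1 [set x | Phi x = d] * y | y in L].
  apply: (@sub_finite_set _ _ (psi @` [set: _])); last exact/finite_image/finite_finset.
  move=> _ [x _ <-]; exists (Phi x) => //.
  apply/eq_left_coset; first by case: nL.
  by apply: PhiP; apply: (xgetPex 1 (P := [set z | Phi z = Phi x])); exists x.
have [l cL] := (finite_setP _).1 fin.
exists L, l; split=> //; first by move=> x [_ Kx]; have := Kx 1; rewrite conjg1.
apply: (@expg_index_pnat _ _ _ _ (n * q) nL cL); first by rewrite pnatM pn.
move=> x; have Nxn y : N (y ^+ n) by apply: normal_index_expg.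
rewrite expgnA; split; first exact: is_subgroupX.
by move=> y; rewrite conjXg; apply/Kq/NH/JN.
Qed.

Lemma p_open_expg (p : nat) (F : groupType) (H : set F) (x : F) :
  p_open p H -> exists2 q, p.-nat q & H (x ^+ q).
Proof.
by case=> _ [N [n [nN NH cN pn]]]; exists n => //; apply: NH; exact: normal_index_expg nN cN.
Qed.

Section Carriers.
Variables (p : nat) (F : groupType).
Implicit Types (s t : Comm p F) (x y z : F).

(** A germ is given by finite data: when [X] generates an open subgroup, [Y]
    determines [s], by [carries_uniq]. *)
Definition carries (I : Type) s (X Y : I -> F) := exists phi : p_iso p F,
  [/\ germ phi = s, forall i, pdom phi (X i) & forall i, phi (X i) = Y i].

Lemma carries_ev (I J : Type) s (X Y : I -> F) (a : J -> word I) :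
  carries s X Y -> carries s (fun j => ev X (a j)) (fun j => ev Y (a j)).
Proof.
move=> [phi [E dX fX]]; exists phi; split=> // j.
  exact: (ev_sub _ (pdom_sub phi)).
rewrite (morph_ev (a j) (pdom_sub phi) (@p_isoM _ _ phi)) //.
exact: eq_ev.
Qed.

Lemma carriesM (I : Type) s t (X Y Z : I -> F) :
  carries s Y Z -> carries t X Y -> carries (s * t) X Z.
Proof.
move=> [phi [<- dY fY]] [psi [<- dX fX]]; exists (p_iso_comp phi psi).
by rewrite germM; split=> // i /=; [split; rewrite ?fX|rewrite fX fY].
Qed.

Lemma carriesV (I : Type) s (X Y : I -> F) : carries s X Y -> carries s^-1 Y X.
Proof.
move=> [phi [<- dX fX]]; exists (p_iso_inv phi); split.
- by rewrite -germ_inv.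
- by move=> i; rewrite -fX; apply: p_iso_fun.
- by move=> i; rewrite /= -fX p_iso_invfunK.
Qed.

Lemma carries1 (I : Type) (X : I -> F) : carries 1 X X.
Proof. by exists (p_iso_id p F). Qed.

Lemma carries_uniq (I : Type) s t (X Y : I -> F) :
  p_open p (hull X) -> carries s X Y -> carries t X Y -> s = t.
Proof.
move=> oX [phi [<- dX fX]] [psi [<- dX' fX']]; apply/germP/germ_eqP.
exists (hull X); split=> //.
- by apply: hull_min dX; exact: pdom_sub.
- by apply: hull_min dX'; exact: pdom_sub.
move=> _ [w _ <-]; rewrite !(morph_ev w (pdom_sub _) (@p_isoM _ _ _)) //.
by apply: eq_ev => i /=; rewrite fX fX'.
Qed.

Lemma free_p_iso (I : choiceType) (X Y : I -> F) :
  is_free X -> is_free Y -> p_open p (hull X) -> p_open p (hull Y) ->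
  exists phi : p_iso p F,
    [/\ pdom phi = hull X, pcod phi = hull Y & forall i, phi (X i) = Y i].
Proof.
move=> fX fY oX oY.
have fM : {in hull X &, {morph ehom X Y : x y / x * y}}.
  by move=> x y; rewrite !inE; apply: ehomM.
have fB : set_bij (hull X) (hull Y) (ehom X Y).
  split=> [_ [w _ <-]|x y|_ [w _ <-]].
  - by rewrite ehomE //; apply: hull_ev.
  - rewrite !inE => -[v _ <-] [w _ <-]; rewrite !ehomE // => E.
    exact: (free_eq fY).
  - by exists (ev X w); [exact: hull_ev|rewrite ehomE].
by exists (PIso oX oY fM fB); split=> // i /=; rewrite ehom_gen.
Qed.

Fact inner_M y : {in [set: F] &, {morph conjg^~ y^-1 : x z / x * z}}.
Proof. by move=> x z _ _; rewrite conjMg. Qed.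

Fact inner_bij y : set_bij [set: F] [set: F] (conjg^~ y^-1).
Proof.
split=> // [x z _ _ /conjg_inj//|x _].
by exists (x ^ y) => //; rewrite conjgK.
Qed.

(** Germs compose on the left, so that [inner] is a homomorphism only with [y^-1] on the
    right of [^]. *)
Definition inner y : Comm p F :=
  germ (PIso (p_openT p F) (p_openT p F) (@inner_M y) (@inner_bij y)).

Lemma inner_carries (I : Type) (X : I -> F) y :
  carries (inner y) X (fun i => X i ^ y^-1).
Proof. by eexists; split; [reflexivity|by []|by []]. Qed.

Lemma carries_innerP (I : Type) (X Y : I -> F) s y : p_open p (hull X) ->
  carries s X Y -> (forall i, Y i = X i ^ y^-1) -> s = inner y.
Proof.
move=> oX sX E; apply: (carries_uniq oX sX).
have -> : Y = (fun i => X i ^ y^-1) by apply/funext.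
exact: inner_carries.
Qed.

Lemma hull_id : hull (@id F) = [set: F].
Proof. by apply/seteqP; split=> // x _; apply: (hull_gen id). Qed.

Lemma innerM y z : inner (y * z) = inner y * inner z.
Proof.
apply/esym; apply: (carries_innerP (X := id)).
- by rewrite hull_id; apply: p_openT.
- apply: carriesM (inner_carries _ _) (inner_carries _ _).
- by move=> x /=; rewrite invgM conjgM.
Qed.

Lemma inner1 : inner 1 = 1.
Proof. by apply: (mulgI (inner 1)); rewrite -innerM !mulg1. Qed.

Lemma innerV y : inner y^-1 = (inner y)^-1.
Proof. by apply: (mulgI (inner y)); rewrite -innerM !mulgV inner1. Qed.

Lemma inner_conj s y z : carries s (fun _ : unit => y) (fun=> z) ->
  s * inner y * s^-1 = inner z.
Proof.
move=> [phi [<- /(_ tt) dy /(_ tt) E]].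
have dom_id : hull (fun x : {x | x \in pcod phi} => val x) = pcod phi.
  apply/seteqP; split.
    by apply: hull_min => [|[x /= xd]]; [case: (pcod_open phi)|rewrite -in_setE].
  by move=> x xd; apply: (hull_gen _ (exist _ x (mem_set xd))).
have [sd] : is_subgroup (pdom phi) /\ is_subgroup (pcod phi).
  by split; [case: (pdom_open phi)|case: (pcod_open phi)].
have h : carries (germ phi * inner y * (germ phi)^-1)
    (fun x : {x | x \in pcod phi} => val x)
    (fun u => phi (p_iso_inv phi (val u) ^ y^-1)).
  have domV (x : {x | x \in pcod phi}) : pdom phi (p_iso_inv phi (val x)).
    by case: (p_iso_inv_bij phi) => h _ _; apply: h; rewrite -in_setE; apply: valP.
  apply: (carriesM (Y := fun u => p_iso_inv phi (val u))).
    apply: carriesM (inner_carries _ _).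
    exists phi; split=> // x; rewrite /conjg invgK.
    have dyV := is_subgroupV sd dy.
    by rewrite mulgA; apply: is_subgroupM => //; apply: is_subgroupM.
  rewrite -[_^-1]/(Comm_inv _) germ_inv; exists (p_iso_inv phi); split=> // x.
  by rewrite -in_setE; apply: valP.
move=> sc; apply: (carries_innerP _ h); first by rewrite dom_id; apply: pcod_open.
case=> x /= xc; have /p_iso_surj[u du <-] : pcod phi x by rewrite -in_setE.
have dyV := is_subgroupV sd dy.
rewrite p_iso_invfunK // /conjg !invgK -E !p_isoM ?p_isoV //.
exact: is_subgroupM.
Qed.

Definition related (S : set (Comm p F)) (I : Type) (X Y : I -> F) :=
  exists2 s, S s & carries s X Y.

Section Related.
Variables (S : set (Comm p F)) (sS : is_subgroup S).

Lemma related_trans (I : Type) (X Y Z : I -> F) :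
  related S X Y -> related S Y Z -> related S X Z.
Proof.
by move=> [s Ss XY] [t St YZ]; exists (t * s); [exact: is_subgroupM|exact: carriesM XY].
Qed.

Lemma related_refl (I : Type) (X : I -> F) : related S X X.
Proof. by exists 1; [exact: is_subgroup1|exact: carries1]. Qed.

(** All the moves out of one family suffice: those out of an equivalent family
    are conjugate to them by elements of [S]. *)
Lemma nequiv_related (I : finType) (X : I -> F) :
  (forall i j l b, i != j -> related S X (move X i j l b)) ->
  forall Y, nequiv X Y -> related S X Y.
Proof.
move=> mX Y; elim=> [|Z i j l b _ IH ij]; first exact: related_refl.
apply: (related_trans IH); have [s Ss XZ] := IH; have [t St XX'] := mX i j l b ij.
exists (s * t * s^-1).
  by apply: is_subgroupM; [|apply: is_subgroupM|apply: is_subgroupV].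
apply: carriesM (carriesV XZ); apply: (carriesM (Y := move X i j l b)) => //.
have moveW (K : groupType) (W : I -> K) : move W i j l b = (fun k => ev W (move_word i j l b k)).
  by apply/funext => k; rewrite -moveE.
by rewrite !moveW; apply: carries_ev.
Qed.

Lemma inner_subgroup : is_subgroup [set y | S (inner y)].
Proof.
apply/is_subgroupP; split=> [|y z Sy Sz] /=; first by rewrite inner1; apply: is_subgroup1.
by rewrite innerM innerV; apply: is_subgroupF.
Qed.

(** Conjugation by a basis element is a Whitehead move. *)
Lemma moves_inner (I : finType) (X : I -> F) : p_open p (hull X) ->
  (forall i j l b, i != j -> related S X (move X i j l b)) ->
  forall y, hull X y -> S (inner y).
Proof.
move=> oX mX; apply: (hull_min inner_subgroup) => i /=.
have [|s Ss sX] := nequiv_related mX (Y := fun k => X k ^ (X i)^-1).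
  apply: (nequiv_whitehead (i := i)); first by rewrite /conjg invgK mulgV mulg1.
  move=> k ki; exists (X i), (X i)^-1; split; last by rewrite /conjg invgK mulgA.
    by right; exists false.
  by right; exists true.
by rewrite -(carries_innerP oX sX (y := X i)).
Qed.

End Related.

Lemma SComm_sub : is_subgroup (SComm p F).
Proof.
apply/is_subgroupP; split=> [M [sM _]|s t Ss St M hM]; first exact: is_subgroup1.
by apply: is_subgroupF; [case: hM|exact: Ss|exact: St].
Qed.

Lemma SAut_SComm (H : set F) s : p_open p H -> SAut p H s -> SComm p F s.
Proof. by move=> oH Hs M [sM]; apply; exists H. Qed.

Section Basis.
Variables (I : finType) (X : I -> F).
Hypotheses (fX : is_free X) (oX : p_open p (hull X)).

Lemma move_SComm i j l b : i != j -> related (SComm p F) X (move X i j l b).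
Proof.
move=> ij; set Y := move X i j l b.
have hY : hull Y = hull X by exact: hull_move.
have [|phi [dphi cphi phiX]] := free_p_iso fX (free_move (l := l) (b := b) ij fX) oX.
  by rewrite -/Y hY.
exists (germ phi); last first.
  by exists phi; split=> // k; rewrite dphi; apply: hull_gen.
apply: (SAut_SComm oX); exists phi => //; split=> //; first by rewrite cphi -/Y hY.
have HY k : hull X (Y k) by rewrite -hY; apply: hull_gen.
apply: (det1_acts_by_SL fX _ phiX HY).
  by move=> x y Hx Hy; apply: p_isoM; rewrite dphi.
rewrite det_move //; last by move=> k; apply: hull_gen.
by rewrite exps_mx1 // det1.
Qed.

Lemma nequiv_SComm Y : nequiv X Y -> related (SComm p F) X Y.
Proof. exact: (nequiv_related SComm_sub move_SComm). Qed.

Lemma inner_SComm y : hull X y -> SComm p F (inner y).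
Proof. exact: (moves_inner SComm_sub oX move_SComm). Qed.

End Basis.

End Carriers.

(** * Cyclic covers *)

Section Wreath.
Variables (L : groupType) (q : nat).

(** The permutational wreath product of [L] with the symmetric group. *)
Definition wreath (L : groupType) (q : nat) : Type := ({ffun 'I_q -> L} * {perm 'I_q})%type.
HB.instance Definition _ := Choice.on (wreath L q).
Local Notation W := (wreath L q).

Definition wreath_mul (g h : W) : W := ([ffun i => g.1 i * h.1 (g.2 i)], g.2 * h.2).
Definition wreath_one : W := ([ffun=> 1], 1).
Definition wreath_inv (g : W) : W := ([ffun i => (g.1 (g.2^-1 i))^-1], g.2^-1).

Fact wreath_mulA : associative wreath_mul.
Proof.
move=> g h k; congr pair; last by rewrite /= mulgA.
by apply/ffunP => i; rewrite !ffunE /= mulgA permM.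
Qed.
Fact wreath_mul1 : left_id wreath_one wreath_mul.
Proof.
move=> [g s]; congr pair; last by rewrite /= mul1g.
by apply/ffunP => i; rewrite !ffunE /= mul1g perm1.
Qed.
Fact wreath_mulr1 : right_id wreath_one wreath_mul.
Proof.
move=> [g s]; congr pair; last by rewrite /= mulg1.
by apply/ffunP => i; rewrite !ffunE /= mulg1.
Qed.
Fact wreath_mulV : left_inverse wreath_one wreath_inv wreath_mul.
Proof.
move=> g; congr pair; last by rewrite /= mulVg.
by apply/ffunP => i; rewrite !ffunE /= mulVg.
Qed.
Fact wreath_mulrV : right_inverse wreath_one wreath_inv wreath_mul.
Proof.
move=> g; congr pair; last by rewrite /= mulgV.
by apply/ffunP => i; rewrite !ffunE /= permK mulgV.
Qed.

HB.instance Definition _ := isGroup.Build W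
  wreath_mulA wreath_mul1 wreath_mulr1 wreath_mulV wreath_mulrV.

End Wreath.

Section Cover.
Variables (J : finType) (q : nat) (q_gt0 : (0 < q)%N).
Let z : 'I_q := Ordinal q_gt0.

(** The words giving the Schreier basis of the kernel of the map to [Z/q] that
    sends the generator [None] to [1] and the others to [0]; [Some (j, m)] is the
    conjugate of [Some j] that lives on the sheet [m]. *)
Definition schreier_word (k : option (J * 'I_q)) : word (option J) :=
  if k is Some (j, m) then
    nseq m (None, false) ++ (Some j, false) :: nseq m (None, true)
  else nseq q (None, false).

Lemma ev_nseq (I : Type) (G : groupType) (X : I -> G) m i b :
  ev X (nseq m (i, b)) = sgn b (X i) ^+ m.
Proof. by elim: m => [|m IH] //=; rewrite IH expgS. Qed.

Definition schreier (G : groupType) (X : option J -> G) (k : option (J * 'I_q)) : G :=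
  if k is Some (j, m) then X (Some j) ^ (X None ^- m) else X None ^+ q.

Lemma ev_schreier_word (G : groupType) (X : option J -> G) k :
  ev X (schreier_word k) = schreier X k.
Proof.
case: k => [[j m]|] /=; last by rewrite ev_nseq.
by rewrite ev_cat /= !ev_nseq /conjg invgK expVgn.
Qed.

Section Free.
Variables (L : groupType) (f : option (J * 'I_q) -> L).

(** The induced representation: [None] turns the [q] sheets, picking up [f None]
    when it closes the circle. *)
Definition induced (i : option J) : wreath L q :=
  if i is Some j then ([ffun m => f (Some (j, m))], 1)
  else ([ffun m : 'I_q => if m.+1 == q then f None else 1], perm (@ordS_inj q)).

Lemma induced_expg m : (m <= q)%N ->
  ((induced None ^+ m).1 z = if m == q then f None else 1) /\
  ((induced None ^+ m).2 z = m %% q :> nat).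
Proof.
elim: m => [_|m IH mq].
  by rewrite expg0 /= ffunE mod0n perm1 (ltn_eqF q_gt0).
have [e1 e2] := IH (ltnW mq); rewrite expgSr; split.
  rewrite ffunE e1 (ltn_eqF mq) mul1g ffunE e2 modn_small //.
by rewrite permM permE /= e2 -addn1 modnDml addn1.
Qed.

Lemma induced_schreier k : (schreier induced k).2 z = z /\ (schreier induced k).1 z = f k.
Proof.
case: k => [[j m]|]; last first.
  have [e1 e2] := induced_expg (leqnn q); rewrite [schreier _ _]/= e1 eqxx; split=> //.
  by apply: val_inj; rewrite /= e2 modnn.
have [e1 e2] := induced_expg (ltnW (ltn_ord m)).
have um : (induced None ^+ m).2 z = m by apply: val_inj; rewrite /= e2 modn_small.
have -> : schreier induced (Some (j, m)) =
    induced None ^+ m * (induced (Some j) * (induced None ^+ m)^-1).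
  by rewrite /schreier /conjg invgK.
set u := _ ^+ m in e1 um *; split.
  by rewrite /= mul1g permM permK.
by rewrite ffunE e1 (ltn_eqF (ltn_ord m)) mul1g ffunE um !ffunE /= perm1 -um permK e1
  (ltn_eqF (ltn_ord m)) invg1 mulg1.
Qed.

End Free.

Section Group.
Variables (G : groupType) (X : option J -> G).
Local Notation Y := (schreier X).

Lemma schreier_free : is_free X -> is_free Y.
Proof.
move=> fX L f w.
rewrite -(eq_ev (ev_schreier_word X)) -ev_subst => /fX-/(_ _ (induced f)).
rewrite ev_subst (eq_ev (ev_schreier_word _)) => E.
pose R := [set g : wreath L q | g.2 z = z].
have sR : is_subgroup R.
  apply/is_subgroupP; split=> /= [|g h gz hz]; first exact: perm1.
  by apply: etrans (permM g.2 h.2^-1 z) _; rewrite gz -{1}hz permK.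
have hM (g h : wreath L q) : R g -> R h -> (g * h).1 z = g.1 z * h.1 z.
  by move=> gz _; rewrite ffunE gz.
have := morph_ev (h := fun g : wreath L q => g.1 z) w sR hM
  (fun k => (induced_schreier f k).1).
rewrite E /= ffunE => ->; apply: eq_ev => k /=.
by rewrite (induced_schreier f k).2.
Qed.

Lemma schreier_hull k : hull X (Y k).
Proof. by rewrite -ev_schreier_word; apply: hull_ev. Qed.

(** The sheet reached from the sheet [i] along a word. *)
Fixpoint sheet (i : 'I_q) (w : word (option J)) : 'I_q :=
  match w with
  | [::] => i
  | (None, b) :: w' => sheet (if b then ord_pred i else ordS i) w'
  | _ :: w' => sheet i w'
  end.

(** Reidemeister-Schreier rewriting of a path that starts on the sheet [i]: [None] is
    written only when the path closes the circle. *)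
Fixpoint rewriting (i : 'I_q) (w : word (option J)) : word (option (J * 'I_q)) :=
  match w with
  | [::] => [::]
  | (None, false) :: w' =>
      if i.+1 == q then (None, false) :: rewriting (ordS i) w' else rewriting (ordS i) w'
  | (None, true) :: w' =>
      if i == 0 :> nat then (None, true) :: rewriting (ord_pred i) w'
      else rewriting (ord_pred i) w'
  | (Some j, b) :: w' => (Some (j, i), b) :: rewriting i w'
  end.

Lemma size_rewriting i w : (size (rewriting i w) <= size w)%N.
Proof.
elim: w i => //= -[[j|] b] w IH i; first by rewrite ltnS.
by case: b; case: ifP => _ /=; rewrite ?ltnS // (leqW (IH _)).
Qed.

Lemma rewriting_letter i w j m b : (Some (j, m), b) \in rewriting i w -> (Some j, b) \in w.
Proof.
elim: w i => //= -[[k|] c] w IH i.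
  rewrite !inE => /orP[/eqP[-> _ ->]|/IH->]; first by rewrite eqxx.
  by rewrite orbT.
by rewrite inE; case: c; case: ifP => _; rewrite ?inE /=; apply: IH.
Qed.

Lemma rewritingE (i : 'I_q) w : X None ^+ i * ev X w = ev Y (rewriting i w) * X None ^+ sheet i w.
Proof.
elim: w i => [|[[j|] b] w IH] i; first by rewrite /= mulg1 mul1g.
- rewrite /= -mulgA -IH !mulgA; congr (_ * _).
  by rewrite sgnJ /conjg invgK mulgA mulgVK.
- have pE : ord_pred i = (if i == 0 :> nat then q.-1 else i.-1) :> nat.
    rewrite /=; have := ltn_ord i; case: eqP => [->|i0] iq.
      by rewrite add0n modn_small // prednK.
    have -> : (i + q).-1 = (i.-1 + q)%N by lia.
    by rewrite modnDr modn_small //; lia.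
  have sE : ordS i = (if i.+1 == q then 0 else i.+1)%N :> nat.
    rewrite /=; have := ltn_ord i; case: eqP => [->|i0] iq; first by rewrite modnn.
    by rewrite modn_small //; lia.
  case: b => /=.
    case: eqP pE => i0 pE /=; rewrite -?mulgA -IH !mulgA; congr (_ * _); rewrite pE.
      have -> : X None ^+ q = X None ^+ q.-1 * X None by rewrite -expgSr prednK.
      by rewrite i0 expg0 mul1g invgM mulgVK.
    by rewrite -{1}(prednK (n := i)) ?expgSr ?mulgK //; lia.
  case: eqP sE => iq sE /=; rewrite -?mulgA -IH !mulgA; congr (_ * _); rewrite sE.
    by rewrite expg0 mulg1 -expgSr iq.
  by rewrite -expgSr.
Qed.

(** The exponent sum of [None], as a natural number modulo [q]. *)
Definition turns (w : word (option J)) : nat :=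
  \sum_(l <- w | l.1 == None) (if l.2 then q.-1 else 1)%N.

Lemma turns_cat v w : turns (v ++ w) = turns v + turns w.
Proof. by rewrite /turns big_cat. Qed.

Lemma turns_winv w : q %| turns w + turns (winv w).
Proof.
rewrite /turns /winv big_rev big_map -big_split /=; apply: dvdn_sum => -[i b] _.
by case: b => /=; rewrite ?addn1 ?add1n prednK.
Qed.

Lemma turns_nseq m b : turns (nseq m (None, b)) = (m * (if b then q.-1 else 1))%N.
Proof. by rewrite /turns; elim: m => [|m IH]; rewrite ?big_nil //= big_cons IH. Qed.

Lemma sheetE (i : 'I_q) w : sheet i w = (i + turns w) %% q :> nat.
Proof.
elim: w i => [|[[j|] b] w IH] i /=; rewrite /turns ?big_nil ?big_cons /=.
- by rewrite addn0 modn_small.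
- exact: IH.
rewrite IH -/(turns w); case: b => /=; rewrite modnDml; congr (_ %% _).
  by have := q_gt0; lia.
by lia.
Qed.

Lemma schreier_ev w : q %| turns w -> ev X w = ev Y (rewriting z w).
Proof.
move=> qw; have := rewritingE z w; have := sheetE z w; rewrite /= add0n.
by move/eqP: qw => -> ->; rewrite !expg0 mul1g mulg1.
Qed.

Lemma schreierP g : hull Y g <-> exists2 w, ev X w = g & q %| turns w.
Proof.
split; last by move=> [w <- qw]; rewrite schreier_ev //; apply: hull_ev.
move: g; apply: (hull_min (H := [set g | exists2 w, ev X w = g & q %| turns w])).
  apply/is_subgroupP; split=> /= [|g h [v <- qv] [w <- qw]].
    by exists [::]; rewrite // /turns big_nil.
  exists (v ++ winv w); first by rewrite ev_cat ev_winv.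
  by rewrite turns_cat dvdn_addr // -(dvdn_addr _ qw) turns_winv.
move=> k /=; exists (schreier_word k); first exact: ev_schreier_word.
case: k => [[j m]|] /=; last by rewrite turns_nseq muln1.
rewrite turns_cat -cat1s turns_cat !turns_nseq /turns big_cons big_nil /=.
by rewrite add0n muln1 -mulnS prednK // dvdn_mull.
Qed.

End Group.

Lemma schreier_open (p : nat) (F : groupType) (X : option J -> F) :
  p_open p (hull X) -> p.-nat q -> p_open p (hull (schreier X)).
Proof.
move=> oX pq.
have sK := hull_sub (schreier X).
apply: (p_open_sub (c := fun g => sheet z (word_of X g)) oX sK _ _ _ pq).
- by apply: hull_min => //; [exact: hull_sub|exact: schreier_hull].
- move=> _ k [v _ <-] /schreierP[w <- qw]; apply/schreierP.
  exists (winv v ++ w ++ v); first by rewrite !ev_cat ev_winv /conjg.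
  by rewrite !turns_cat addnCA dvdn_addr // addnC turns_winv.
- move=> _ [w _ <-]; apply/schreierP.
  suff h m : exists2 v, ev X v = ev X w ^+ m & turns v = (m * turns w)%N.
    by have [v <- E] := h q; exists v; rewrite // E dvdn_mulr.
  elim: m => [|m [v E T]]; first by exists [::]; rewrite // /turns big_nil.
  by exists (w ++ v); rewrite ?ev_cat ?E ?expgS // turns_cat T mulSn.
- move=> h h' Hh Hh' E; apply/schreierP.
  rewrite -(word_ofK Hh) -(word_ofK Hh'); move: (word_of X h) (word_of X h') E => v w.
  move=> /(congr1 val) /=; rewrite !sheetE !add0n => E.
  exists (winv v ++ w); first by rewrite ev_cat ev_winv.
  rewrite turns_cat; apply/dvdnP/dvdnP; rewrite /dvdn -modnDmr -E modnDmr addnC.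
  exact: turns_winv.
Qed.

End Cover.

(** * Moves on a cover *)

(** The multipliers do not change, so the moves can be made one after the other. *)
Lemma nequiv_moves (I : finType) (G : groupType) (Y Y' : I -> G) (D : pred I)
    (f : I -> I) (l b : bool) :
  (forall k, D k -> ~~ D (f k)) ->
  (forall k, ~~ D k -> Y' k = Y k) ->
  (forall k, D k -> Y' k = move Y k (f k) l b k) -> nequiv Y Y'.
Proof.
move=> fD Y'0 Y'1.
suff h (s : seq I) : nequiv Y (fun k => if k \in s then Y' k else Y k).
  by have := h (enum I); congr nequiv; apply/funext => k; rewrite mem_enum.
elim: s => [|k s IH]; first exact: nequiv_refl.
have [ks|ks] := boolP ((k \in s) || ~~ D k).
  move: IH; congr nequiv; apply/funext => m; rewrite inE.
  by case: eqP => //= ->; case/orP: ks => [->//|/Y'0 ->]; rewrite if_same.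
move: ks; rewrite negb_or negbK => /andP[ks Dk].
have nkf : k != f k by apply: contraNneq (fD k Dk) => <-.
apply: nequiv_trans IH _; set Z := fun m => _.
have := nequiv1 Z l b nkf; congr nequiv; apply/funext => m.
rewrite /move /upd inE; case: eqP => [->|_] //=.
have -> : Z k = Y k by rewrite /Z (negPf ks).
have -> : Z (f k) = Y (f k) by rewrite /Z Y'0 ?if_same //; apply: fD.
by rewrite Y'1 // /move updE.
Qed.

Section CoverMoves.
Variables (J : finType) (q : nat) (G : groupType) (X : option J -> G).
Local Notation Y := (@schreier J q G).

Lemma nequiv_cover_some i j l b : i != j ->
  nequiv (Y X) (Y (move X (Some i) (Some j) l b)).
Proof.
move=> ij; pose D (k : option (J * 'I_q)) := if k is Some (i', _) then i' == i else false.
pose f (k : option (J * 'I_q)) := if k is Some (_, m) then Some (j, m) else None.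
have ij' : Some i != Some j by [].
apply: (nequiv_moves (D := D) (f := f) (l := l) (b := b)).
- by case=> [[i' m]|] //= _; rewrite eq_sym.
- by move=> [[i' m]|] /= i'i; rewrite /move !upd_neq.
- case=> [[i' m]|] //= /eqP ->; rewrite /move !updE upd_neq //=.
  by case: l; rewrite conjMg sgnJ.
Qed.

(** With [P k = (a x)^k x^-k], the images of the Schreier generators under
    [x |-> a x] are obtained by [q] Whitehead moves, the [k]-th one multiplying
    by the conjugate by [P k] of the generator [x^k a x^-k]. *)
Lemma nequiv_cover_none j : nequiv (Y X) (Y (move X None (Some j) true false)).
Proof.
set X' := move X _ _ _ _; set x := X None; set a := X (Some j).
have X'N : X' None = a * x by rewrite /X' /move updE.
have X'S i : X' (Some i) = X (Some i) by rewrite /X' /move upd_neq.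
pose P k := (a * x) ^+ k * x ^- k.
have PS k : P k.+1 = (a ^ (x ^- k)) ^ (P k)^-1 * P k.
  rewrite /P /conjg !invgK invgM invgK expgSr [x ^+ k.+1]expgSr invgM !mulgA.
  by rewrite !(mulgVK, mulgK).
pose B k (c : option (J * 'I_q)) :=
  if c is Some (i, m) then (X (Some i) ^ (x ^- m)) ^ (P (minn k m))^-1 else P k * x ^+ q.
suff h k : (k <= q)%N -> nequiv (B 0%N) (B k).
  have := h q (leqnn q); congr nequiv; apply/funext => -[[i m]|] /=.
  - by rewrite min0n /P !expg0 invg1 mulg1 invg1 conjg1.
  - by rewrite /P !expg0 invg1 mulg1 mul1g.
  - rewrite (minn_idPr (ltnW (ltn_ord m))) X'S X'N -conjgM -invgM.
    by rewrite /P mulgVK.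
  - by rewrite X'N /P mulgVK.
elim: k => [_|k IH kq]; first exact: nequiv_refl.
apply: nequiv_trans (IH (ltnW kq)) _.
pose o := Ordinal kq.
have Bo : B k (Some (j, o)) = (a ^ (x ^- k)) ^ (P k)^-1 by rewrite /= minnn.
apply: (nequiv_whitehead (i := Some (j, o))).
  by rewrite Bo /= (minn_idPr (leqnSn k)).
move=> [[i m]|] nm; last first.
  exists (B k (Some (j, o))), 1; split; [by right; exists false|by left|].
  by rewrite mulg1 Bo /= PS -mulgA.
have [mk|km] := leqP m k.
  exists 1, 1; split; [by left|by left|].
  by rewrite mul1g mulg1 /= (minn_idPr mk) (minn_idPr (leqW mk)).
exists (B k (Some (j, o))), (B k (Some (j, o)))^-1; split.
- by right; exists false.
- by right; exists true.
rewrite Bo /= (minn_idPl (ltnW km)) (minn_idPl km) PS invgM conjgM.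
by rewrite [RHS]/(_ * _ * _) -[in LHS]/(_ ^ _) [LHS]conjgE invgK mulgA.
Qed.

End CoverMoves.

(** * Moves realized by a normal subgroup *)

Lemma eq_ev_in (I : eqType) (G : groupType) (X Y : I -> G) w :
  (forall l, l \in w -> X l.1 = Y l.1) -> ev X w = ev Y w.
Proof.
elim: w => //= l w IH h; rewrite h ?mem_head // IH // => k kw.
by apply: h; rewrite inE kw orbT.
Qed.

(** Along [w] the sheet changes from [0] to [sheet z w], which shifts the generators by
    that amount; a [None] enters the conjugator when the shift goes round the circle. *)
Lemma schreier_conj (F : groupType) (J : finType) (q : nat) (q_gt0 : (0 < q)%N)
    (X : option J -> F) w (m : 'I_q) :
  let z := Ordinal q_gt0 in
  let c := rewriting z w ++ (if (sheet z w + m < q)%N then [::] else [:: (None, false)]) in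
  forall j, schreier X (Some (j, m)) ^ (ev X w)^-1 =
    schreier X (Some (j, Ordinal (ltn_pmod (sheet z w + m) q_gt0))) ^ (ev (schreier X) c)^-1.
Proof.
move=> z c j.
have yE := rewritingE q_gt0 X z w; rewrite /= expg0 mul1g in yE.
have cE : ev X w * X None ^+ m = ev (schreier X) c * X None ^+ ((sheet z w + m) %% q).
  rewrite /c ev_cat yE -mulgA -expgnDr -mulgA; congr (_ * _).
  case: ltnP => h; first by rewrite /= mul1g modn_small.
  rewrite /= mulg1 -expgnDr; congr (_ ^+ _).
  have mE : ((sheet z w + m) %% q = sheet z w + m - q)%N.
    rewrite -{1}(subnK h) modnDr modn_small //.
    by have := ltn_ord (sheet z w); have := ltn_ord m; lia.
  by rewrite mE subnKC.
by rewrite /schreier -!conjgM -!invgM cE.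
Qed.

Section NormalSubgroup.
Variables (p : nat) (F : groupType) (S : set (Comm p F)).
Hypotheses (p_pr : prime p) (sS : is_subgroup S) (nS : normalized_by (SComm p F) S).

Lemma normal_conj s t : SComm p F t -> S s -> S (t * s * t^-1).
Proof.
move=> St Ss; have tV := is_subgroupV (SComm_sub p F) St.
by rewrite -(nS tV); exists s; rewrite // /conjg invgK mulgA.
Qed.

Definition good (I : finType) (X : I -> F) :=
  forall i j l b, i != j -> related S X (move X i j l b).

Lemma carries_move (I : finType) (s : Comm p F) (X Y : I -> F) i j l b :
  carries s X Y -> carries s (move X i j l b) (move Y i j l b).
Proof.
have moveW (W : I -> F) : move W i j l b = (fun k => ev W (move_word i j l b k)).
  by apply/funext => k; rewrite -moveE.
by rewrite !moveW; apply: carries_ev.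
Qed.

(** Signed permutations of determinant one conjugate the given move to all the others;
    the spare index [l] leaves the signs at [i] and [k] free. *)
Lemma one_move_good (I : finType) (X : I -> F) i k l :
  is_free X -> p_open p (hull X) -> i != k -> l != i -> l != k ->
  related S X (move X i k false false) -> good X.
Proof.
move=> fX oX ik li lk [s Ss sX] i' k' left b ik'.
have [pi [e [XW pii pik ei ek]]] := nequiv_place X left (b (+) left) ik li lk ik'.
set W := sperm X pi e in XW.
have [t St tXW] := nequiv_SComm fX oX XW.
exists (t * s * t^-1); first exact: normal_conj.
have sW : carries (t * s * t^-1) W (move W i k false false).
  apply: carriesM (carriesV tXW); apply: (carriesM (Y := move X i k false false)) => //.
  exact: carries_move.
pose a m : word I := [:: (pi^-1 m, e (pi^-1 m))].
have XE j : X (pi j) = sgn (e j) (W j) by rewrite /W /sperm sgnK.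
have aX : (fun m => ev W (a m)) = X.
  by apply/funext => m; rewrite ev1 /= -XE permKV.
suff aX' : (fun m => ev (move W i k false false) (a m)) = move X i' k' left b.
  by rewrite -aX' -{1}aX; apply: carries_ev.
apply/funext => m; rewrite ev1 /= -{3}(permKV pi m); move: (pi^-1 m) => j.
rewrite /move /upd -pii (inj_eq perm_inj) -pik !XE; case: eqP => [->|//].
rewrite ei ek /=; case: (left) => /=; last by rewrite addbF sgnK.
by rewrite addbT invgM sgnD addbN addbb.
Qed.

Lemma cover_related (J : finType) (q : nat) (X X' : option J -> F) :
  (0 < q)%N -> p.-nat q -> is_free X -> p_open p (hull X) ->
  is_free X' -> p_open p (hull X') ->
  related S (@schreier J q F X) (@schreier J q F X') -> related S X X'.
Proof.
move=> q0 pq fX oX fX' oX' [s Ss sY].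
have [phi [dphi _ phiX]] := free_p_iso fX fX' oX oX'.
have c : carries (germ phi) X X'.
  by exists phi; split=> // i; rewrite dphi; apply: hull_gen.
have Yw (Z : option J -> F) : schreier Z = (fun k => ev Z (@schreier_word J q k)).
  by apply/funext => k; rewrite ev_schreier_word.
exists s => //; rewrite (carries_uniq _ sY (t := germ phi)) //; last first.
  by rewrite !Yw; apply: carries_ev.
exact: schreier_open.
Qed.

Lemma move_commute (I : finType) (Y : I -> F) (s t : Comm p F) i j k l :
  p_open p (hull Y) -> i != j -> k != l -> i != k -> i != l -> k != j ->
  carries s Y (move Y i j false false) -> carries t Y (move Y k l false false) ->
  s * t = t * s.
Proof.
move=> oY ij kl ik il kj sY tY; apply: (carries_uniq oY).
  apply: carriesM tY; exact: (carries_move _ _ _ _ sY).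
have -> : move (move Y i j false false) k l false false =
    move (move Y k l false false) i j false false.
  apply/funext => m; rewrite /move /upd.
  have -> : (k == i) = false by rewrite eq_sym; apply/negbTE.
  have -> : (l == i) = false by rewrite eq_sym; apply/negbTE.
  have -> : (j == k) = false by rewrite eq_sym; apply/negbTE.
  by rewrite (negPf ik); have [->|_] := eqVneq m k; rewrite // eq_sym (negPf ik).
by apply: carriesM sY; exact: (carries_move _ _ _ _ tY).
Qed.

(** The main construction.  In the cover [Y] of degree [p], a move [tau] of the
    entries [a1, a2] on the sheet [0] is conjugated by [y] to the same move [mu] on
    the sheet [e <> 0], because [y] does not involve these entries.  So [S]
    contains [mu tau^-1]; its commutator with the move [rho] of [a2] by [a3] on
    the sheet [0] is a single move of [a1] by [a3]. *)
Lemma inner_good (J : finType) (X : option J -> F) w a1 a2 a3 :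
  is_free X -> p_open p (hull X) -> S (inner p (ev X w)) ->
  ~~ (p %| turns p w) -> a1 != a2 -> a1 != a3 -> a2 != a3 ->
  (forall b, [/\ (Some a1, b) \notin w, (Some a2, b) \notin w & (Some a3, b) \notin w]) ->
  good X.
Proof.
move=> fX oX Sy pw a12 a13 a23 wa.
have p0 := prime_gt0 p_pr; pose z := Ordinal p0; set y := ev X w in Sy.
pose Y := @schreier J p F X.
have pp : p.-nat p by rewrite pnat_id.
have fY : is_free Y by exact: schreier_free.
have oY : p_open p (hull Y) by exact: schreier_open.
pose e := sheet z w; have eE : e = turns p w %% p :> nat by rewrite /e sheetE.
have e0 : e != z by rewrite -val_eqE /= eE -/(dvdn _ _).
pose A a m : option (J * 'I_p) := Some (a, m).
have AE a m b n : (A a m == A b n) = (a == b) && (m == n) by [].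
have Ane a b m n : a != b -> A a m != A b n by move=> ab; rewrite AE negb_and ab.
have [tau Stau ctau] := move_SComm fY oY false false (Ane a1 a2 z z a12).
have [rho Srho crho] := move_SComm fY oY false false (Ane a2 a3 z z a23).
have [mu Smu cmu] := move_SComm fY oY false false (Ane a1 a2 e e a12).
have [nu Snu cnu] := move_SComm fY oY false false (Ane a1 a3 z z a13).
(* [c k] conjugates the shifted generator [sh k] to the conjugate of [k] by [y]; as it does
   not contain [A a1 e], the move [mu] fixes it *)
have conj_tau : inner p y * tau = mu * inner p y.
  apply: (carries_uniq oY); first exact: carriesM (inner_carries _ _ _) ctau.
  pose sh (k : option (J * 'I_p)) : option (J * 'I_p) :=
    if k is Some (j, m) then Some (j, Ordinal (ltn_pmod (e + m) p0)) else None.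
  pose c (k : option (J * 'I_p)) : word (option (J * 'I_p)) :=
    rewriting z w ++ if k is Some (_, m) then
      if (e + m < p)%N then [::] else [:: (None, false)] else [::].
  pose U k := c k ++ (sh k, false) :: winv (c k).
  have conjE : (fun k => Y k ^ y^-1) = (fun k => ev Y (U k)).
    apply/funext => k; rewrite /U ev_cat ev_cons ev_winv /=.
    have -> (g h : F) : g * (h * g^-1) = h ^ g^-1 by rewrite /conjg invgK.
    case: k => [[j m]|]; first exact: schreier_conj.
    have := rewritingE p0 X z w; rewrite /= expg0 mul1g -/y => ->.
    rewrite /c cats0 invgM conjgM; congr (_ ^ _).
    by rewrite /Y /= conjXg /conjg invgK mulgA -expgSr expgS mulgK.
  rewrite -/Y in conjE.
  have cY : carries (inner p y) Y (fun k => ev Y (U k)) by rewrite -conjE; apply: inner_carries.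
  have := carriesM (carries_ev U cmu) cY; congr carries; apply/funext => k.
  have fixc : ev (move Y (A a1 e) (A a2 e) false false) (c k) = ev Y (c k).
    apply: eq_ev_in => -[i b] ib; rewrite /move upd_neq //; apply: contraTneq ib => /= ->.
    have [n1 _ _] := wa b; apply: contra n1; rewrite mem_cat => /orP[|].
      exact: rewriting_letter.
    by case: k => [[j m]|] //; case: ifP.
  rewrite /U ev_cat ev_cons ev_winv fixc /=.
  have UE k' : Y k' ^ y^-1 = ev Y (c k') * (Y (sh k') * (ev Y (c k'))^-1).
    by have := congr1 (@^~ k') conjE; rewrite /U ev_cat ev_cons ev_winv.
  have [->|kn] := eqVneq k (A a1 z).
    rewrite {2}/move updE conjMg !UE.
    have -> : sh (A a1 z) = A a1 e.
      by congr (Some (_, _)); apply: val_inj; rewrite /= addn0 modn_small.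
    have -> : sh (A a2 z) = A a2 e.
      by congr (Some (_, _)); apply: val_inj; rewrite /= addn0 modn_small.
    by rewrite /move updE -/(c (A a2 z)) [c (A a2 z)]/(c (A a1 z)) !mulgA mulgVK.
  rewrite [in RHS]/move [in RHS]upd_neq // UE; congr (_ * (_ * _)).
  rewrite /move upd_neq //; case: k kn {fixc} => [[j m]|] //=.
  rewrite !AE; apply: contra => /andP[-> /eqP /(congr1 val) /= em].
  have [le lm] := (ltn_ord e, ltn_ord m); rewrite -val_eqE /=.
  move: em; have [h|h] := ltnP (e + m) p; first by rewrite modn_small //; lia.
  have -> : ((e + m) %% p = e + m - p)%N.
    by rewrite -{1}(subnK h) modnDr modn_small; lia.
  lia.
have S1 : S (mu * tau^-1).
  have -> : mu = inner p y * tau * (inner p y)^-1 by rewrite conj_tau mulgK.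
  rewrite -!mulgA; apply: is_subgroupM => //; rewrite mulgA.
  by apply: normal_conj => //; apply: is_subgroupV.
have Ae a : A a e != A a z by rewrite AE negb_and e0 orbT.
have mu_tau : mu * tau = tau * mu.
  apply: (move_commute oY (Ane _ _ _ _ a12) (Ane _ _ _ _ a12) (Ae a1)
    (Ane _ _ _ _ a12) (Ane _ _ _ _ a12) cmu ctau).
have mu_rho : mu * rho = rho * mu.
  apply: (move_commute oY (Ane _ _ _ _ a12) (Ane _ _ _ _ a23) (Ane _ _ _ _ a12)
    (Ane _ _ _ _ a13) _ cmu crho).
  by rewrite eq_sym Ae.
(* the relation [[tau^-1, rho] = nu] between moves of three entries; the move [mu] drops
   out because it commutes with [tau] and [rho] *)
have rho_tau : rho * tau = tau * nu * rho.
  apply: (carries_uniq oY); first exact: carriesM (carries_move _ _ _ _ crho) ctau.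
  rewrite -mulgA.
  have := carriesM (carries_move (A a2 z) (A a3 z) false false
      (carries_move (A a1 z) (A a3 z) false false ctau))
    (carriesM (carries_move (A a2 z) (A a3 z) false false cnu) crho).
  congr carries; apply/funext => k; rewrite /move /upd !AE !eqxx !andbT.
  have neF (a b : J) : a != b -> ((a == b) = false) * ((b == a) = false).
    by move=> ab; rewrite [b == a]eq_sym (negPf ab).
  rewrite !(neF _ _ a12, neF _ _ a13, neF _ _ a23) /=.
  have [->|_] := eqVneq k (A a2 z); first by rewrite AE (neF _ _ a12).
  by case: eqP => // _; rewrite -mulgA.
have goodY : good Y.
  apply: (one_move_good fY oY (i := A a1 z) (k := A a3 z) (l := A a2 z)).
  - by rewrite AE negb_and a13.
  - by rewrite AE negb_and eq_sym a12.
  - by rewrite AE negb_and a23.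
  exists nu => //.
  have -> : nu = mu * tau^-1 * (rho * (mu * tau^-1)^-1 * rho^-1).
    have comm (s t u : Comm p F) : s * t = t * s -> s * t^-1 = t^-1 * s.
      by move=> E; apply: (mulgI t); apply: (mulIg t); rewrite mulVKg !mulgA mulgVK.
    rewrite invgM invgK.
    have -> : mu * tau^-1 = tau^-1 * mu.
      by apply: (mulgI tau); rewrite mulVKg mulgA -mu_tau mulgK.
    rewrite !mulgA; apply: (mulIg rho); rewrite mulgVK.
    rewrite -[tau^-1 * mu * rho]mulgA mu_rho !mulgA.
    rewrite -[tau^-1 * rho * mu * tau]mulgA mu_tau !mulgA mulgK.
    by rewrite -[tau^-1 * rho * tau]mulgA rho_tau !mulgA mulVg mul1g.
  apply: is_subgroupM => //.
  by apply: normal_conj => //; apply: is_subgroupV.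
apply: (one_move_good fX oX (i := Some a1) (k := Some a3) (l := Some a2)) => //.
  by rewrite (inj_eq Some_inj) eq_sym.
apply: (cover_related p0 pp) => //.
- exact: free_move.
- by rewrite hull_move.
by apply: (nequiv_related sS goodY); apply: nequiv_cover_some.
Qed.

End NormalSubgroup.

(** * Elements in general position *)

Section Pointing.
Variables (I : finType) (i0 : I) (e : I -> bool).

Local Notation J := {i : I | i != i0}.

(** Brings any letter, of either sign, to the position and sign that the cyclic
    covers single out. *)
Definition pointed (G : groupType) (X : I -> G) (o : option J) : G :=
  if o is Some k then sgn (e (val k)) (X (val k)) else sgn (e i0) (X i0).

Definition pointing (l : letter I) : letter (option J) := (insub l.1, l.2 (+) e l.1).

Lemma pointed_insub (G : groupType) (X : I -> G) i : pointed X (insub i) = sgn (e i) (X i).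
Proof. by rewrite /pointed; case: insubP => [k _ <-|/negbNE/eqP->]. Qed.

Lemma ev_pointing (G : groupType) (X : I -> G) w :
  ev (pointed X) (map pointing w) = ev X w.
Proof.
by elim: w => //= l w ->; rewrite pointed_insub sgnD -addbA addbb addbF.
Qed.

Lemma pointing_self l : l.1 = i0 -> pointing l = (None, l.2 (+) e i0).
Proof. by move=> E; rewrite /pointing E insubN // negbK. Qed.

Lemma pointed_free (G : groupType) (X : I -> G) : is_free X -> is_free (pointed X).
Proof.
move=> fX; pose a (o : option J) : word I :=
  if o is Some k then [:: (val k, e (val k))] else [:: (i0, e i0)].
apply: (free_subst (a := a) fX) => [[k|]|K f]; try by rewrite ev1.
exists (fun i => sgn (e i) (f (insub i))) => -[k|]; rewrite ev1 /= sgnK.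
  by rewrite valK.
by rewrite insubN // negbK.
Qed.

Lemma pointed_hull (G : groupType) (X : I -> G) : hull (pointed X) = hull X.
Proof.
apply: hull_eq => [[k|]|i] /=; try by apply: sgn_sub; [exact: hull_sub|exact: hull_gen].
by rewrite -[X i](sgnK (e i)) -pointed_insub; apply: sgn_sub;
  [exact: hull_sub|exact: hull_gen].
Qed.

Lemma card_pointed : #|{: J}| = #|I|.-1.
Proof.
by rewrite card_sig -(cardC1 i0); apply: eq_card => i; rewrite !inE.
Qed.

End Pointing.

Arguments pointed {I} i0 e {G} X.
Arguments pointing {I} i0 e l.

(** Give the first letter the sign [+].  If its exponent sum is divisible by [p], pass to
    the cyclic cover that it defines: there the first letter does not close the
    circle, hence is not written, and the word becomes shorter. *)
Lemma descend (p : nat) (F : groupType) (J : finType) (X : option J -> F) w :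
  prime p -> is_free X -> p_open p (hull X) -> ev X w != 1 ->
  exists (J' : finType) (X' : option J' -> F) w',
    [/\ is_free X', p_open p (hull X'), ev X' w' = ev X w &
     [/\ (size w' <= size w)%N, (#|J| <= #|J'|)%N & ~~ (p %| turns p w')]].
Proof.
move=> p_pr; have p0 := prime_gt0 p_pr; have p1 := prime_gt1 p_pr.
have [n] := ubnP (size w); elim: n J X w => // n IH J X [|l w] sw fX oX; first by rewrite eqxx.
pose e (_ : option J) := l.2; pose X0 := pointed l.1 e X.
set w0 := map (pointing l.1 e) (l :: w).
have fX0 : is_free X0 by exact: pointed_free.
have oX0 : p_open p (hull X0) by rewrite pointed_hull.
have E0 : ev X0 w0 = ev X (l :: w) by exact: ev_pointing.
have c0 : #|{: {i : option J | i != l.1}}| = #|J| by rewrite card_pointed card_option.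
have w0E : w0 = (None, false) :: map (pointing l.1 e) w.
  by rewrite /w0 map_cons pointing_self // /e addbb.
move=> n1; have [pw|pw] := boolP (p %| turns p w0); last first.
  exists _, X0, w0; split=> //; split=> //; last by rewrite c0.
  by rewrite size_map.
have E1 := schreier_ev p0 X0 pw.
set w1 := rewriting _ w0 in E1.
have s1 : (size w1 <= size w)%N.
  rewrite /w1 w0E /= (ltn_eqF p1).
  by apply: leq_trans (size_rewriting _ _) _; rewrite size_map.
have [||||J' [X' [w' [fX' oX' E' [s' c' pw']]]]] := IH _ (@schreier _ p F X0) w1.
- exact: leq_ltn_trans s1 _.
- exact: schreier_free.
- by apply: schreier_open; rewrite ?pnat_id.
- by rewrite -E1 E0.
exists J', X', w'; split; [by []|by []|by rewrite E' -E1 E0|split=> //].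
  by apply: leq_trans s' (leqW s1).
apply: leq_trans c'; rewrite card_prod card_ord c0.
by apply: leq_pmulr.
Qed.

Lemma three_unused (J : finType) (w : word (option J)) : (size w + 3 <= #|J|)%N ->
  exists a1 a2 a3 : J, [/\ a1 != a2, a1 != a3, a2 != a3 &
    forall b, [/\ (Some a1, b) \notin w, (Some a2, b) \notin w & (Some a3, b) \notin w]].
Proof.
move=> sw; pose D := [set j : J | Some j \in map fst w]%SET.
have : (2 < #|~: D|)%N.
  have : (#|D| <= size w)%N.
    rewrite -(size_map fst) -(card_imset _ (@Some_inj _)).
    apply: leq_trans (card_size _); apply: subset_leq_card.
    by apply/fintype.subsetP => _ /imsetP[j jD ->]; move: jD; rewrite inE.
  by have := cardsC D; lia.
case/card_gt2P => a1 [a2 [a3 [[h1 h2 h3] [n12 n23 n31]]]].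
have U a b : a \in ~: D -> (Some a, b) \notin w.
  by rewrite !inE; apply: contra => h; apply/mapP; exists (Some a, b).
by exists a1, a2, a3; split=> // [|b]; [rewrite eq_sym|split; apply: U].
Qed.

Section NormalSubgroupMoves.
Variables (p : nat) (F : groupType) (S : set (Comm p F)).
Hypotheses (p_pr : prime p) (sS : is_subgroup S) (nS : normalized_by (SComm p F) S).

(** If a germ [s] of [phi] moves [x], the commutator of [s] and [inner x] is
    [inner (phi x * x^-1)]. *)
Lemma exists_inner (I : finType) (X : I -> F) : is_free X -> hull X = [set: F] ->
  S <> [set 1] -> exists2 y, y != 1 & S (inner p y).
Proof.
move=> fX hX S1.
have oX : p_open p (hull X) by rewrite hX; apply: p_openT.
have [s Ss s1] : exists2 s, S s & s <> 1.
  apply: contrapT => h; apply: S1; apply/seteqP; split=> [s Ss|_ ->].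
    by apply: contrapT => s1; apply: h; exists s.
  exact: is_subgroup1.
have [phi phis] : exists phi, germ phi = s by exists (generic_quotient.repr s); apply: germ_repr.
have [x dx xn] : exists2 x, pdom phi x & phi x <> x.
  apply: contrapT => h; apply: s1; rewrite -phis.
  apply/germP/germ_eqP; exists (pdom phi); split=> // [|x dx /=]; first exact: pdom_open.
  by apply: contrapT => n; apply: h; exists x.
exists (phi x * x^-1); first by apply/eqP => /divg1_eq.
have Sx : SComm p F (inner p x) by apply: (inner_SComm fX oX); rewrite hX.
have E : s * inner p x * s^-1 = inner p (phi x).
  by apply: inner_conj; exists phi; split.
rewrite innerM innerV -E -!mulgA; apply: is_subgroupM => //; rewrite mulgA.
by apply: normal_conj => //; apply: is_subgroupV.
Qed.

(** In the cover of degree [p], conjugation by [ev X w] takes the generator [Some j] of the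
    sheet [0] to a conjugate of one of another sheet, and an abelian quotient tells
    these apart. *)
Lemma commutator_neq1 (J : finType) (X : option J -> F) w j :
  is_free X -> ~~ (p %| turns p w) ->
  ev X (w ++ (Some j, false) :: winv w ++ [:: (Some j, true)]) != 1.
Proof.
move=> fX pw; have p0 := prime_gt0 p_pr; pose z := Ordinal p0.
apply/eqP; rewrite ev_cat ev_cons ev_cat ev_winv ev1 /= !mulgA => /divg1_eq E.
have := schreier_conj p0 X w z j; rewrite -/z; set c := _ ++ _; set m := Ordinal _.
have -> : schreier X (Some (j, z)) = X (Some j) by rewrite /= expg0 invg1 conjg1.
have -> : X (Some j) ^ (ev X w)^-1 = X (Some j) by rewrite /conjg invgK mulgA.
move=> E1; pose v := c ++ (Some (j, m), false) :: winv c.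
have {E1} E1 : ev (schreier X) v = ev (schreier X) [:: (Some (j, z), false)].
  rewrite /v ev_cat ev_cons ev_winv ev1 /= expg0 invg1 conjg1 [RHS]E1.
  by rewrite [RHS]conjgE invgK.
pose f (k : option (J * 'I_p)) : addgrp int := if k == Some (j, z) then 1%R else 0%R.
have := free_eq (schreier_free p0 fX) f E1.
rewrite ev1 /v ev_cat ev_cons ev_winv /=.
have -> : f (Some (j, z)) = 1%R by rewrite /f eqxx.
have -> : f (Some (j, m)) = 1.
  rewrite /f; case: eqP => // -[].
  by rewrite addn0 (sheetE p0) modn_mod /= add0n => /eqP; rewrite -/(dvdn _ _) (negPf pw).
by rewrite mul1g mulgV.
Qed.

(** In a cover of large degree a commutator involves few of the many generators.  The
    descent neither lengthens the word nor lowers the rank, so that [inner_good]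
    applies to its outcome. *)
Lemma open_inner (J : finType) (X : option J -> F) :
  is_free X -> hull X = [set: F] -> (0 < #|J|)%N -> S <> [set 1] ->
  exists2 H, p_open p H & forall y, H y -> S (inner p y).
Proof.
move=> fX hX J0 S1; have p1 := prime_gt1 p_pr.
have oX : p_open p (hull X) by rewrite hX; apply: p_openT.
have Sx y : SComm p F (inner p y) by apply: (inner_SComm fX oX); rewrite hX.
have [y y1 Sy] := exists_inner fX hX S1.
have [w0 _ w0E] : hull X y by rewrite hX.
rewrite -{}w0E in y1 Sy.
have [J1 [X1 [w1 [fX1 oX1 E1 [_ c1 pw1]]]]] := descend p_pr fX oX y1.
have /card_gt0P[j _] : (0 < #|J1|)%N by apply: leq_trans c1.
set w2 := w1 ++ (Some j, false) :: winv w1 ++ [:: (Some j, true)].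
have y2 : ev X1 w2 != 1 by exact: commutator_neq1.
have Sy2 : S (inner p (ev X1 w2)).
  rewrite /w2 ev_cat ev_cons ev_cat ev_winv ev1 E1 /=.
  rewrite innerM; apply: is_subgroupM => //.
  by rewrite mulgA !innerM !innerV; apply: normal_conj => //; apply: is_subgroupV.
(* the degree leaves at least three generators out of a word of length [size w2] *)
pose q := (p ^ (size w2 + 3))%N.
have q0 : (0 < q)%N by rewrite expn_gt0 prime_gt0.
have qw2 : (q %| turns q w2)%N.
  rewrite /w2 -cat1s !turns_cat -[(Some j, false) :: _]cat1s.
  by rewrite /turns !big_cons !big_nil /= !addn0 add0n -!/(turns _ _) turns_winv.
have E3 := schreier_ev q0 X1 qw2.
rewrite E3 in y2 Sy2.
have [||J4 [X4 [w4 [fX4 oX4 E4 [s4 c4 pw4]]]]] := descend p_pr _ _ y2.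
- exact: schreier_free.
- by apply: schreier_open; rewrite // pnatX pnat_id.
have [|a1 [a2 [a3 [n12 n13 n23 wa]]]] := @three_unused J4 w4.
  apply: leq_trans c4; rewrite card_prod card_ord.
  apply: (@leq_trans q); last first.
    by apply: leq_pmull; apply/card_gt0P; exists j.
  apply: (@leq_trans (size w2 + 3)); last by rewrite ltnW // ltn_expl.
  by rewrite leq_add2r (leq_trans s4) // size_rewriting.
have g4 : good S X4.
  by apply: (inner_good p_pr sS nS fX4 oX4 _ pw4 n12 n13 n23 wa); rewrite E4.
by exists (hull X4) => //; apply: (moves_inner sS oX4 g4).
Qed.

(** A power [x^q] of the basis element [None] is a generator of the cover of
    degree [q]; since [S] contains its inner germ, all moves of this cover come from
    [S], in particular those that make up [x |-> a x]. *)
Lemma good_none (H : set F) (J : finType) (X : option J -> F) j :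
  p_open p H -> (forall y, H y -> S (inner p y)) ->
  is_free X -> p_open p (hull X) ->
  related S X (move X None (Some j) true false).
Proof.
move=> oH HS fX oX; have p1 := prime_gt1 p_pr.
have [m pm Hm] := p_open_expg (X None) oH.
(* the factor [p ^ 4] provides the sheets for three generators that differ from [None] *)
pose q := (m * p ^ 4)%N.
have pq : p.-nat q by rewrite pnatM pm pnatX pnat_id.
have q4 : (4 <= q)%N.
  apply: (@leq_trans (p ^ 4)); first by rewrite ltnW // ltn_expl.
  by apply: leq_pmull; case/andP: pm.
have q0 : (0 < q)%N by exact: leq_trans q4.
have [|a1 [a2 [a3 [n12 n13 n23 wa]]]] := @three_unused (J * 'I_q)%type [:: (None, false)].
  rewrite card_prod card_ord; apply: leq_trans q4 _.
  by apply: leq_pmull; apply/card_gt0P; exists j.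
have gY : good S (@schreier _ q F X).
  apply: (inner_good (w := [:: (None, false)]) p_pr sS nS _ _ _ _ n12 n13 n23 wa).
  - exact: schreier_free.
  - exact: schreier_open.
  - by rewrite ev1 /= expgnA; apply: HS; apply: is_subgroupX Hm; case: oH.
  - by rewrite /turns big_cons big_nil /= addn0 dvdn1 neq_ltn p1 orbT.
apply: (cover_related q0 pq fX oX).
- exact: free_move.
- by rewrite hull_move.
by apply: (nequiv_related sS gY); apply: nequiv_cover_none.
Qed.

Lemma all_good (H : set F) : p_open p H -> (forall y, H y -> S (inner p y)) ->
  forall (I : finType) (X : I -> F), is_free X -> p_open p (hull X) -> good S X.
Proof.
move=> oH HS I X fX oX i j l b ij.
pose e k := if k == i then ~~ l else b (+) ~~ l.
pose X0 := pointed i e X.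
have ji : j != i by rewrite eq_sym.
pose j0 : {k : I | k != i} := Sub j ji.
have [||s Ss sX0] := @good_none H _ X0 j0 oH HS.
- exact: pointed_free.
- by rewrite pointed_hull.
exists s => //.
pose a k : word (option {k : I | k != i}) := [:: (insub k, e k)].
have aX : (fun k => ev X0 (a k)) = X.
  by apply/funext => k; rewrite ev1 [_.2]/= [_.1]/= /X0 pointed_insub sgnK.
suff aX' : (fun k => ev (move X0 None (Some j0) true false) (a k)) = move X i j l b.
  by rewrite -aX' -{1}aX; apply: carries_ev.
apply/funext => k; rewrite ev1 /=; have [->|ki] := eqVneq k i.
  rewrite insubN ?negbK // /move !updE /X0 /= /e eqxx (negPf ji).
  by case: (l); rewrite /= ?addbF // invgM invgK addbT sgnV invgK.
rewrite /move upd_neq; last by rewrite insubT.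
by rewrite /X0 pointed_insub sgnK upd_neq.
Qed.

End NormalSubgroupMoves.

(** * Bases of open subgroups *)

Lemma nequiv_powers (I : finType) (G : groupType) (X : I -> G) i (a : I -> nat) :
  nequiv X (fun k => if k == i then X i else X k * X i ^- a k).
Proof.
pose Z m k := if k == i then X i else X k * X i ^- minn m (a k).
have ZZ m : nequiv (Z 0%N) (Z m).
  elim: m => [|m IH]; first exact: nequiv_refl.
  apply: nequiv_trans IH _; apply: (nequiv_whitehead (i := i)); first by rewrite /Z eqxx.
  move=> k ki; rewrite /Z eqxx (negPf ki).
  have [am|ma] := leqP (a k) m.
    exists 1, 1; split; [by left|by left|].
    by rewrite mul1g mulg1 (minn_idPr (leqW am)).
  exists 1, (X i)^-1; split; [by left|by right; exists true|].
  by rewrite (minn_idPl ma) expgS invgM mul1g mulgA.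
have := ZZ (\max_k a k); congr nequiv; apply/funext => k; rewrite /Z.
  by case: eqP => [->//|_]; rewrite min0n expg0 invg1 mulg1.
by rewrite (minn_idPr (leq_bigmax k)).
Qed.

Section Image.
Variables (F : groupType) (T : finGroupType) (q : F -> T).
Hypothesis qM : {morph q : x y / x * y}.

Definition image_set (K : set F) : {set T} := [set u | `[< exists2 x, K x & q x = u >]]%SET.

Lemma image_setP K u : reflect (exists2 x, K x & q x = u) (u \in image_set K).
Proof. by rewrite inE; apply: asboolP. Qed.

Lemma image_in (K : set F) x : K x -> q x \in image_set K.
Proof. by move=> Kx; apply/image_setP; exists x. Qed.

Lemma image_group_set K : is_subgroup K -> group_set (image_set K).
Proof.
move=> sK; apply/group_setP; split.
  apply/image_setP; exists 1; first exact: is_subgroup1.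
  by apply: (mulgI (q 1)); rewrite -qM !mulg1.
move=> _ _ /image_setP[x Kx <-] /image_setP[y Ky <-]; apply/image_setP.
by exists (x * y); [exact: is_subgroupM|].
Qed.

End Image.

(** If the open subgroup [H] is not everything, then in a finite [p]-quotient its
    image lies in a normal subgroup of index [p]; after a change of basis the
    preimage of the latter is a cyclic cover. *)
Lemma open_basis (p : nat) (F : groupType) (H : set F) (I : finType) (X : I -> F) :
  prime p -> is_free X -> hull X = [set: F] -> p_open p H ->
  exists (I' : finType) (X' : I' -> F), is_free X' /\ hull X' = H.
Proof.
move=> p_pr fX hX oH; have p0 := prime_gt0 p_pr.
have [sH [N [n [nN NH cN pn]]]] := oH.
have [q [Q [qM q1 QP cQ]]] := normal_quotient_perm nN cN.
have oX : p_open p (hull X) by rewrite hX; apply: p_openT.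
have HX : H `<=` hull X by rewrite hX.
have [m] := ubnP #|image_set q (hull X)|.
elim: m I X fX oX HX {hX} => // m IH I X fX oX HX sm.
pose A := Group (image_group_set qM (hull_sub X)).
pose B := Group (image_group_set qM sH).
have BA : B \subset A.
  by apply/fintype.subsetP => _ /image_setP[x Hx <-]; apply/image_in/HX.
have pA : p.-group A.
  apply: (@pgroupS _ _ Q); last by rewrite /pgroup cQ.
  by apply/fintype.subsetP => _ /image_setP[x _ <-]; apply/QP; exists x.
have [/= BeqA|[M maxM BM]] := maximal_exists BA.
  exists I, X; split=> //; apply/seteqP; split=> // x Xx.
  have : q x \in image_set q H by rewrite BeqA image_in.
  case/image_setP => h Hh E; rewrite -[x](mulVKg h); apply: is_subgroupM => //.
  by apply/NH/q1; apply: (mulgI (q h)); rewrite -qM mulVKg mulg1.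
have nMA := p_maximal_normal pA maxM.
have iM := p_maximal_index pA maxM.
have [MA nM] := andP nMA.
have cAM : #|(A / M)%g| = p by rewrite card_quotient.
pose k x := coset M (q x).
have kM x y : hull X x -> hull X y -> k (x * y) = k x * k y.
  by move=> Xx Xy; rewrite /k qM morphM //; apply: (fintype.subsetP nM); apply: image_in.
have kin x : hull X x -> k x \in (A / M)%g.
  by move=> Xx; apply: mem_quotient; apply: image_in.
have k1 x : hull X x -> k x = 1 -> q x \in M.
  by move=> Xx; apply: coset_idr; apply: (fintype.subsetP nM); apply: image_in.
have [i0 ki0] : exists i, k (X i) != 1.
  apply: contrapT => h; have : (A \subset M).
    apply/fintype.subsetP => _ /image_setP[x Xx <-]; apply: (k1 _ Xx).
    case: Xx => w _ <-; rewrite (morph_ev w (hull_sub X) kM (hull_gen X)).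
    apply: (ev_sub (H := [set 1])) => [|i /=].
      by apply/is_subgroupP; split=> //= ? ? -> ->; rewrite mulgV.
    by apply: contrapT => n1; apply: h; exists i; apply/eqP.
  by have /proper_subn/negP := maxgroupp maxM.
set c := k (X i0) in ki0.
have oc : #[c] = p.
  apply: nt_prime_order => //; rewrite -cAM; apply: expg_cardG.
  by apply: kin; apply: hull_gen.
have cA : <[c]> = (A / M)%g.
  apply/eqP; rewrite eqEcard cycle_subG kin ?cAM -?orderE ?oc ?leqnn //.
  exact: hull_gen.
have /choice[a aP] : forall i, exists m, k (X i) = c ^+ m.
  move=> i; have : k (X i) \in <[c]> by rewrite cA; apply/kin/hull_gen.
  by case/cycleP => j ->; exists j.
set X' := fun i => if i == i0 then X i0 else X i * X i0 ^- a i.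
have XX' : nequiv X X' by exact: nequiv_powers.
pose X0 := pointed i0 (fun=> false) X'.
have hX0 : hull X0 = hull X by rewrite pointed_hull (nequiv_hull XX').
have fX0 : is_free X0 by apply: pointed_free; apply: nequiv_free fX.
have kX0 o : k (X0 o) = if o is Some _ then 1 else c.
  case: o => [[i ii0]|] /=; rewrite /X' ?eqxx // (negPf ii0).
  have XV : hull X (X i0 ^- a i).
    by apply: is_subgroupV; [|apply: is_subgroupX]; try exact: hull_sub; exact: hull_gen.
  have XX : hull X (X i0 ^+ a i).
    by apply: is_subgroupX; [exact: hull_sub|exact: hull_gen].
  apply: (mulIg (k (X i0 ^+ a i))).
  rewrite -kM //; last by apply: is_subgroupM => //; [exact: hull_sub|exact: hull_gen].
  rewrite mulgVK mul1g aP.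
  elim: (a i) => [|j IHj]; first by
    rewrite !expg0 /k; have /q1 -> := is_subgroup1 nN.1; rewrite morph1.
  rewrite !expgS kM ?IHj //; first exact: hull_gen.
  by apply: is_subgroupX; [exact: hull_sub|exact: hull_gen].
have kw w : k (ev X0 w) = c ^+ turns p w.
  rewrite (morph_ev w (hull_sub X) kM) => [|o]; last by rewrite -hX0; apply: hull_gen.
  rewrite (eq_ev (Y := fun o => if o is Some _ then 1 else c)) //.
  elim: w => [|[[j|] b] w IHw]; rewrite ?ev_cons /turns ?big_nil ?big_cons //= IHw -/(turns p w).
    by case: b; rewrite /= ?invg1 mul1g.
  rewrite expgnDr; case: b => /=; rewrite ?expg1 //; congr (_ * _).
  by apply: (mulgI c); rewrite mulgV -expgS prednK // -oc expg_order.
have dvdE w : (p %| turns p w)%N = (c ^+ turns p w == 1) by rewrite -order_dvdn oc.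
have oY : p_open p (hull (schreier (q := p) X0)).
  by apply: schreier_open; rewrite ?hX0 // pnat_id.
apply: (IH _ (schreier (q := p) X0)) => //.
- exact: schreier_free.
- move=> h Hh; have : hull X0 h by rewrite hX0; apply: HX.
  case=> w _ wh; apply/(schreierP p0); exists w => //.
  rewrite dvdE -kw wh; apply/eqP; apply: coset_id.
  by apply: (fintype.subsetP BM); apply: image_in.
rewrite -ltnS; apply: leq_trans sm; rewrite ltnS.
apply: leq_ltn_trans (proper_card (maxgroupp maxM)); apply: subset_leq_card.
apply/fintype.subsetP => _ /image_setP[y Yy <-].
have Xy : hull X y.
  by rewrite -hX0; move: y Yy; apply: hull_min; [exact: hull_sub|exact: schreier_hull].
apply: k1 => //; case/(schreierP p0): Yy => w <-.
by rewrite kw dvdE => /eqP.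
Qed.

(** * The normal subgroups of the commensurator *)

Lemma nequiv_det (I : finType) (G : groupType) (X Y Z : I -> G) :
  is_free X -> hull Y = hull X -> nequiv Y Z ->
  (\det (exps_mx X Z) = \det (exps_mx X Y))%R.
Proof.
move=> fX hY; elim=> // W i j l b YW IH ij; rewrite det_move //.
by move=> k; rewrite -hY -(nequiv_hull YW); apply: hull_gen.
Qed.

(** By Nielsen's theorem [Y] is equivalent to a signed permutation of [X], hence to
    [X] up to one sign, and the determinant excludes that sign. *)
Lemma nielsen_det1 (I : finType) (G : groupType) (X Y : I -> G) :
  is_free X -> hull Y = hull X -> (\det (exps_mx X Y) = 1)%R -> nequiv X Y.
Proof.
move=> fX hY dY; apply: nequiv_sym.
have [Z YZ /choice[l ZE]] := nielsen fX hY.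
have hZ : hull Z = hull X by rewrite (nequiv_hull YZ).
pose f i := (l i).1.
have f_onto i : exists j, f j = i.
  apply: contrapT => h; have : hull Z (X i) by rewrite hZ; apply: hull_gen.
  case=> w _; pose a k : word I := [:: l k].
  rewrite (eq_ev (Y := fun k => ev X (a k))) => [|k]; last by rewrite ev1 ZE.
  rewrite -ev_subst => /(congr1 (fun g => exps X g 0%R (enum_rank i))).
  rewrite exps_count // exps_gen // mxE !eqxx /=.
  have cnt b : count_mem (i, b) (wsubst a w) = 0%N.
    apply/count_memPn/negP => /flatten_mapP[[k c] _] /=.
    case: c; rewrite /a /winv /= inE => /eqP E; apply: h; exists k; rewrite /f.
      by have := congr1 fst E.
    by rewrite -E.
  by rewrite !cnt.
have f_inj : injective f.
  apply/injectiveP/card_uniqP; rewrite size_codom; apply: eq_card => i; rewrite inE.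
  by have [j <-] := f_onto i; apply: codom_f.
have ZS : Z = sperm X (perm f_inj) (fun k => (l k).2).
  by apply/funext => k; rewrite /sperm permE ZE.
have [o Zo] := nequiv_sort X (perm f_inj) (fun k => (l k).2).
rewrite -ZS in Zo; have YX := nequiv_trans YZ Zo.
case: o YX {Zo} => [i|] YX; last by move: YX; congr nequiv; apply/funext.
have := nequiv_det fX hY YX; rewrite dY => /eqP.
set W := fun k => _; have -> : exps_mx X W =
    (diag_mx (\row_a (if a == enum_rank i then -1 else 1)))%R.
  apply/row_matrixP => a; rewrite rowK row_diag_mx mxE.
  have eV : (exps X (X i)^-1 = - exps X (X i))%R.
    apply/eqP; rewrite -GRing.addr_eq0 -expsM //.
    - by rewrite mulVg (exps_ev fX [::]) big_nil.
    - by apply: is_subgroupV; [exact: hull_sub|exact: hull_gen].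
    - exact: hull_gen.
  rewrite /W (inj_eq Some_inj) -(inj_eq enum_rank_inj) enum_valK eq_sym.
  case: eqP => [->|_] /=; last by rewrite exps_gen // enum_valK GRing.scale1r.
  by rewrite enum_rankK eV exps_gen // GRing.scaleN1r.
rewrite det_diag (bigD1 (enum_rank i)) //= mxE eqxx big1 => [|a ai].
  by [].
by rewrite mxE (negPf ai).
Qed.

Lemma hull_commute (I : finType) (G : groupType) (X : I -> G) :
  (#|I| <= 1)%N -> forall x y, hull X x -> hull X y -> commute x y.
Proof.
move=> I1 x y Xx; have ij (i j : I) : i = j.
  by move/card_le1_eqP: I1; apply.
have sC (g : G) : is_subgroup [set z | commute g z].
  apply/is_subgroupP; split=> /= [|u v gu gv]; first exact: commute1.
  by apply: commuteM => //; apply: commuteV.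
apply: (hull_min (sC x)) => j /=; apply: commute_sym.
by move: x Xx; apply: (hull_min (sC _)) => i /=; rewrite (ij i j).
Qed.

Theorem theorem9p1 (p : nat) (F : groupType) (S : set (Comm p F)) :
  prime p ->
  free_of_finite_rank F -> ~ (forall x y : F, commute x y) ->
  is_subgroup S -> S <> [set 1] -> normalized_by (SComm p F) S ->
  SComm p F `<=` S.
Proof.
move=> p_pr [r [X bX]] nab sS S1 nS.
have [fX hX] := free_basis bX.
have r1 : (1 < r)%N.
  rewrite ltnNge; apply/negP => r1; apply: nab => x y.
  by apply: (@hull_commute _ _ X); rewrite ?card_ord ?hX.
pose i0 := Ordinal (ltnW r1).
pose X0 := pointed i0 (fun=> false) X.
have [||||H oH HS] := @open_inner p F S p_pr sS nS _ X0.
- exact: pointed_free.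
- by rewrite pointed_hull.
- by rewrite card_pointed card_ord -subn1 subn_gt0.
- exact: S1.
move=> s; apply; split=> // t [U oU [f [domf codf SLf] <-]].
have [I [Z [fZ hZ]]] := open_basis p_pr fX hX oU.
have oZ : p_open p (hull Z) by rewrite hZ.
have fM x y : hull Z x -> hull Z y -> f (x * y) = f x * f y.
  by rewrite hZ -domf; apply: p_isoM.
have hfZ : hull (f \o Z) = hull Z.
  rewrite hZ -codf; apply/seteqP; split.
    apply: hull_min => [|i /=]; first by case: (pcod_open f).
    by apply: p_iso_fun; rewrite domf -hZ; apply: hull_gen.
  move=> y /p_iso_surj[x + <-]; rewrite domf -hZ => -[w _ <-].
  by rewrite (morph_ev w (hull_sub Z) fM (hull_gen Z)); apply: hull_ev.
have ZfZ : nequiv Z (f \o Z).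
  apply: nielsen_det1 => //; apply: (acts_by_SL_det1 fZ fM) => //.
    by move=> i; rewrite -hfZ; apply: (hull_gen (f \o Z)).
  by rewrite hZ.
have gZ : good S Z := all_good p_pr sS nS oH HS fZ oZ.
have [u Su uZ] := nequiv_related sS gZ ZfZ.
rewrite (carries_uniq oZ _ uZ (s := germ f)) //.
by exists f; split=> // i; rewrite domf -hZ; apply: hull_gen.
Qed.
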